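(* There is an absolute constant $C>0$ such that the following holds. Consider the system $x_{t+1}=A^*x_t+w_t$, $t=0,1,\dots,T-1$, with $A^*\in\mathbb{R}^{d\times d}$ and random $x_0,w_0,\dots,w_{T-1}\in\mathbb{R}^d$, satisfying the following assumptions listed in the context: (Operator norm), (Maximum sub-Gaussian norm) with constant $\sigma_w>0$, (Non-degeneracy) with constant $\lambda>0$, and (Probabilistic attack) with attack probability $0<p<0.5$. Let $\tau=\sigma_w/\lambda$ and let $\delta\in(0,1]$. If $$T\ \ge\ C\cdot\frac{d\cdot\max\{1,\tau^{10}\}}{p(1-2p)^2(1-\|A^*\|_2)^2}\cdot\max\left\{1,\ \log\left(\frac{d\cdot\tau}{\delta(1-2p)(1-\|A^*\|_2)}\right)\right\},$$ then, with probability at least $1-\delta$, the $l_1$-norm estimator at time $T$ achieves exact recovery, i.e. $A^*$ is the unique solution of $$\min_{A\in\mathbb{R}^{d\times d}}\ \sum_{t=0}^{T-1}\|x_{t+1}-Ax_t\|_1 .$$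
   Context: Norms. $\|A\|_2$ is the operator norm of a matrix; $\|\cdot\|_1,\|\cdot\|_2$ are the $l_1$- and $l_2$-norms of vectors; $\succeq$ is the positive semidefinite order. Sub-Gaussian variables. A scalar random variable $w$ is sub-Gaussian if $\mathbb{E}[\exp(w^2/c^2)]\le 2$ for some $c>0$, and its norm is $\|w\|_{\psi_2}=\inf\{c>0:\mathbb{E}[\exp(w^2/c^2)]\le 2\}$. A random vector $w\in\mathbb{R}^d$ is sub-Gaussian if $w^Tx$ is a sub-Gaussian scalar for every $x\in\mathbb{R}^d$, and $\|w\|_{\psi_2}=\sup_{\|x\|_2\le 1}\|w^Tx\|_{\psi_2}$. ''Conditioned on $\mathcal{F}$'' means that expectations are replaced by conditional expectations given $\mathcal{F}$. Filtration. $\mathcal{F}_t=\sigma\{x_0,w_0,\dots,w_{t-1}\}$. The distribution of $w_t$ may depend on $\mathcal{F}_t$ (the disturbance may be chosen adversarially from past information), and $\mathbb{E}[w_t\mid\mathcal{F}_t]$ need not be zero. Assumptions. (Operator norm) $\|A^*\|_2<1$. (Maximum sub-Gaussian norm) There is $\sigma_w>0$ with $\|x_0\|_{\psi_2}\le\sigma_w$ and, for all $t\ge 0$, $\|w_t\|_{\psi_2}\le\sigma_w$ conditioned on $\mathcal{F}_t$ (for every $\mathcal{F}_t$). (Probabilistic attack) At each time $t\ge0$, conditionally on $\mathcal{F}_t$ (for every $\mathcal{F}_t$), the system is not under attack with probability $1-p$, in which case $w_t$ is identically zero: $\mathbb{P}(w_t\equiv 0\mid\mathcal{F}_t)=1-p$;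 with probability $p$ it is under attack. The set of attack times is $\mathcal{K}_T=\{0\le t\le T-1: w_t\text{ is not identically zero}\}$. Conditions imposed below ''at attack times'' concern the distribution of $w_t$ given $\mathcal{F}_t$ and given that $t$ is an attack time. (Non-degeneracy) There is $\lambda>0$ such that for every $x\in\mathbb{R}^d$, $\mathbb{E}[(x+w_t)(x+w_t)^T\mid\mathcal{F}_t]\succeq\lambda^2 I_d$ for all $t\in\mathcal{K}_T$ (i.e. at attack times) and all $\mathcal{F}_t$.
   Formalization: The bound on the sub-Gaussian norm of w_t by sigma_w is required conditionally on F_t and on whether t is an attack time, not on F_t alone; with conditioning on F_t alone the claim fails for small p (no absolute C works). *)

(* Defs.v *)
From HB Require Import structures.
From mathcomp Require Import all_boot all_order all_algebra.
From mathcomp Require Import all_classical all_reals all_analysis.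
From mathcomp Require Import measurable_realfun.
Set Implicit Arguments.
Unset Strict Implicit.
Unset Printing Implicit Defensive.
Import Order.TTheory GRing.Theory Num.Theory.
Import numFieldNormedType.Exports.
Local Open Scope classical_set_scope.
Local Open Scope ring_scope.

(* The library norm `|v| on matrices is the sup norm, so the l1 norm, the l2
   norm and the induced operator norm are introduced here. *)
Definition dotv (R : realType) d (u v : 'cV[R]_d) : R := \sum_i u i 0 * v i 0.

Definition l1norm (R : realType) d (v : 'cV[R]_d) : R := \sum_i `|v i 0|.

Definition l2norm (R : realType) d (v : 'cV[R]_d) : R :=
  Num.sqrt (\sum_i v i 0 ^+ 2).

Definition opnorm (R : realType) d (A : 'M[R]_d) : R :=
  sup [set l2norm (A *m v) | v in [set v | l2norm v <= 1]].

Definition psd (R : realType) d (M : 'M[R]_d) : Prop :=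
  M^T = M /\ forall z : 'cV[R]_d, 0 <= (z^T *m M *m z) 0 0.

Definition loewner_le (R : realType) d (M N : 'M[R]_d) : Prop := psd (N - M).

(* R^d as a measurable type: matrices carry their topology but no canonical
   sigma-algebra in the library. *)
Definition borelV (R : realType) (d : nat) :=
  g_sigma_algebraType (@open 'cV[R]_d).

(* Both psi_2 norms live in \bar R: the infimum over the empty set is +oo, so
   an upper bound by a real number entails sub-Gaussianity. *)
Definition psi2_norm (R : realType) (dT : measure_display)
    (T : measurableType dT) (mu : {measure set T -> \bar R}) (f : T -> R)
    : \bar R :=
  ereal_inf [set c%:E | c in [set c : R | 0 < c /\
    (\int[mu]_y (expR (f y ^+ 2 / c ^+ 2))%:E <= 2%:E)%E]].

Definition psi2_vnorm (R : realType) (dT : measure_display)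
    (T : measurableType dT) (d : nat) (mu : {measure set T -> \bar R})
    (W : T -> 'cV[R]_d) : \bar R :=
  ereal_sup [set psi2_norm mu (fun y => dotv (W y) z)
            | z in [set z : 'cV[R]_d | l2norm z <= 1]].

(* E[(z + W)(z + W)^T], entrywise *)
Definition shifted_second_moment (R : realType) (dT : measure_display)
    (T : measurableType dT) (d : nat) (mu : {measure set T -> \bar R})
    (W : T -> 'cV[R]_d) (z : 'cV[R]_d) : 'M[R]_d :=
  \matrix_(i, j) Rintegral mu setT
    (fun y => ((z + W y) *m (z + W y)^T) i j).

(* f is a version of P(A | <<s G>>). *)
Definition is_cond_prob (R : realType) (dO : measure_display)
    (Omega : measurableType dO) (P : probability Omega R)
    (G : set (set Omega)) (A : set Omega) (f : Omega -> \bar R) : Prop :=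
  (forall Y : set (\bar R), measurable Y -> <<s G >> (f @^-1` Y)) /\
  forall E, <<s G >> E -> (\int[P]_(omega in E) f omega = P (E `&` A))%E.

(* K is a regular conditional distribution of W given <<s G>>. *)
Definition is_cond_law (R : realType) (dO : measure_display)
    (Omega : measurableType dO) (P : probability Omega R) (d : nat)
    (G : set (set Omega)) (W : Omega -> 'cV[R]_d)
    (K : Omega -> probability (borelV R d) R) : Prop :=
  forall B : set (borelV R d), measurable B ->
    is_cond_prob P G (W @^-1` B) (fun omega => K omega B).

(* <<s past x0 w t>> is the sigma-algebra F_t = sigma(x_0, w_0, .., w_(t-1)). *)
Definition past (R : realType) (Omega : Type) (d : nat)
    (x0 : Omega -> 'cV[R]_d) (w : nat -> Omega -> 'cV[R]_d) (t : nat)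
    : set (set Omega) :=
  preimage_set_system setT x0 (measurable : set (set (borelV R d))) `|`
  \bigcup_(s in `I_t)
    preimage_set_system setT (w s) (measurable : set (set (borelV R d))).

(* The event "t is an attack time", i.e. t \in K_T. *)
Definition attack (R : realType) (Omega : Type) (d : nat)
    (w : nat -> Omega -> 'cV[R]_d) (t : nat) : set Omega :=
  [set omega | w t omega != 0].

(* Generators of the join of F_t and sigma(attack w t): a conditional law given
   this sigma-algebra is, on the event attack w t, the law of w_t given F_t and
   given that t is an attack time, and off this event it is the point mass at
   0. The law of w_t given F_t alone is the mixture of the two with weights p
   and 1 - p; a psi_2 bound on that mixture follows from the same bound on its
   components, but not conversely: it leaves room for an extra factor of order
   sqrt (log (1 / p)) at attack times. *)
Definition past_status (R : realType) (Omega : Type) (d : nat)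
    (x0 : Omega -> 'cV[R]_d) (w : nat -> Omega -> 'cV[R]_d) (t : nat)
    : set (set Omega) :=
  past x0 w t `|` [set attack w t].

Definition l1_objective (R : realType) (d T : nat) (x : nat -> 'cV[R]_d)
    (A : 'M[R]_d) : R :=
  \sum_(t < T) l1norm (x t.+1 - A *m x t).

Definition unique_minimizer (R : realType) (U : Type) (f : U -> R) (a : U)
    : Prop :=
  (forall b, f a <= f b) /\ (forall b, (forall c, f b <= f c) -> b = a).

(* Main.v *)
(* Row by row, A* is the unique minimizer as soon as
   sum_t xi_t |v . x_t| > 0 for every v <> 0, with xi_t = 1 at calm times and
   xi_t = -1 at attack times; given the past, xi_t has mean 1 - 2 p. For a fixed
   v of norm between 1/4 and 1, three exponential supermartingales give this:
   - a Hoeffding bound with compensator (1 - 2 p) a_t - 8 a_t^2, for a_t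
     proportional to |v . x_t|;
   - an upper bound on sum_t (v . x_t)^2 of order T p s^2 / (1 - |A*|)^2, where
     s = 2 sigma_w, from a quadratic Lyapunov function adapted to v, whose value
     at w_t is a convex combination of squares (u . w_t)^2 with |u| <= 1;
   - a lower bound on sum_t |v . x_t| of order T p lambda / tau^4, from
     non-degeneracy and the fourth moments (Paley-Zygmund).
   A union bound over a grid handles all v at once. Its mesh is governed by
   sum_t |x_t| <= (|x_0| + sum_t |w_t|) / (1 - |A*|), whose mean is at most of
   order d s (1 + T p) / (1 - |A*|), so no log (1 / p) is lost. *)
Require Import Defs.
From HB Require Import structures.
From mathcomp Require Import all_boot all_order all_algebra.
From mathcomp Require Import all_classical all_reals all_analysis.
From mathcomp Require Import measurable_realfun.
From mathcomp Require Import ring lra.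
Set Implicit Arguments.
Unset Strict Implicit.
Unset Printing Implicit Defensive.
Import Order.TTheory GRing.Theory Num.Theory.
Import numFieldNormedType.Exports.
Local Open Scope classical_set_scope.
Local Open Scope ring_scope.

(** The adversary sees the past and [x_t] is unbounded, so neither independence nor bounded
    increments are available. Every probabilistic estimate is reduced to one step against an
    arbitrary nonnegative weight measurable for the past, and the Hoeffding compensator is quadratic
    in [a_t], paid for by the bound on the sum of squares. In the energy and excitation bounds a
    calm step has factor at most 1 and an attack a constant factor, which gives [1 + p] and
    [1 - p * k] with [k] of order [tau^-4]; both exponents then scale with [N = p * T], which makes
    them comparable. The power 10 comes from balancing. Write [q = 1 - 2 p], [r] for half of one
    minus the operator norm, and [l = lambda / 4]. The drift is of order [q l k N] and the quadratic
    compensator of order [N s^2 / r^2], so the best Hoeffding parameter asks that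
    [N (q l k r)^2 / s^2] dominate the logarithm of the grid size over [delta]. There [k^2]
    contributes [tau^-8] and [l^2 / s^2] contributes [tau^-2]; [q^2] and [r^2] appear in the same
    way, and the factor [d] comes from that logarithm. *)

(** * Disintegration and conditional laws *)

Section slice_kernel.
Context d1 d2 (X : measurableType d1) (Y : measurableType d2) (R : realType).
Variable k : R.-pker X ~> Y.

(** The law of the pair [(x, y)] with [x] frozen and [y] drawn from [k x]. The dummy factor [unit]
    is there because [mkcomp] takes its second kernel over the product of the source and the
    intermediate space, and [mu] enters as a constant kernel from [unit]. *)
Definition slice_ker (ux : unit * X) : {measure set (X * Y) -> \bar R} :=
  measure_function_pushforward__canonical__measure_function_Measure
    (k ux.2) (pair1_measurable ux.2).

Lemma slice_kerE ux U : slice_ker ux U = k ux.2 (xsection U ux.2).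
Proof. by rewrite /slice_ker /= /pushforward xsectionE. Qed.

Let measurable_slice_ker U : measurable U ->
  measurable_fun [set: unit * X] (slice_ker ^~ U).
Proof.
move=> mU.
have -> : slice_ker ^~ U = (fun x => k x (xsection U x)) \o snd.
  by apply/funext => ux; rewrite slice_kerE.
apply: measurableT_comp => //.
by apply: measurable_fun_xsection_finite_kernel; rewrite inE.
Qed.

HB.instance Definition _ :=
  isKernel.Build _ _ _ _ _ slice_ker measurable_slice_ker.

Let slice_ker_prob ux : slice_ker ux [set: X * Y] = 1%E.
Proof. by rewrite slice_kerE xsectionE preimage_setT prob_kernel. Qed.

HB.instance Definition _ :=
  Kernel_isProbability.Build _ _ _ _ _ slice_ker slice_ker_prob.

End slice_kernel.

(** Rectangles form a pi-system generating the product sigma-algebra, so [nu] is the composition of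
    [mu] with [slice_ker k], and integrals against a composition of kernels iterate. *)
Lemma integral_disintegration d1 d2 (X : measurableType d1)
    (Y : measurableType d2) (R : realType) (mu : probability X R)
    (k : R.-pker X ~> Y) (nu : {measure set (X * Y) -> \bar R}) :
  (forall A B, measurable A -> measurable B ->
    nu (A `*` B) = \int[mu]_(x in A) k x B)%E ->
  forall f : X * Y -> \bar R, (forall z, 0 <= f z)%E ->
  measurable_fun setT f ->
  (\int[nu]_z f z = \int[mu]_x \int[k x]_y f (x, y))%E.
Proof.
move=> nuE f f0 mf.
pose l := kprobability (@measurable_cst _ _ unit _ setT
  (mu : pprobability X R)) : R.-pker unit ~> X.
have lE u (g : X -> \bar R) : (\int[l u]_x g x = \int[mu]_x g x)%E by [].
have nuk U : measurable U -> mkcomp l (slice_ker k) tt U = nu U.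
  pose C : set (set (X * Y)) :=
    [set A `*` B | A in measurable & B in measurable].
  move=> mU; apply/esym/(measure_unique C (fun=> setT)) => //.
  - by rewrite measurable_prod_measurableType.
  - move=> _ _ [A mA [B mB <-]] [A' mA' [B' mB' <-]].
    rewrite -setXI; exists (A `&` A'); first exact: measurableI.
    by exists (B `&` B') => //; exact: measurableI.
  - by move=> _; exists setT => //; exists setT => //; rewrite setXTT.
  - by rewrite bigcup_const //; exists 0%N.
  - move=> _ [A mA [B mB <-]].
    rewrite nuE // /mkcomp /= /kcomp lE integral_mkcond.
    apply: eq_integral => x _; rewrite slice_kerE /= patchE.
    case: ifPn => xA; first by rewrite in_xsectionX.
    by rewrite notin_xsectionX // measure0.
  - by move=> _; rewrite -setXTT nuE // (eq_integral (cst 1%E)) ?integral_cst//=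
      ?probability_setT ?ltry// => x _; rewrite prob_kernel.
rewrite -(eq_measure_integral _ (fun U mU _ => nuk U mU)).
rewrite integral_kcomp // lE.
apply: eq_integral => x _.
rewrite ge0_integral_pushforward //.
Qed.

Section probability_kernel_of.
Context d1 d2 (X : measurableType d1) (Y : measurableType d2) (R : realType).
Variable k : X -> probability Y R.
Hypothesis mk : forall U, measurable U -> measurable_fun [set: X] (k ^~ U).

(** The measurability proof is an argument, absent from the body, so that the kernel structures
    declared below can be attached to the term. *)
Definition prob_ker of (forall U, measurable U -> measurable_fun [set: X] (k ^~ U)) :
  X -> {measure set Y -> \bar R} := k.

HB.instance Definition _ := isKernel.Build _ _ _ _ _ (prob_ker mk) mk.

Let prob_ker_prob x : prob_ker mk x [set: Y] = 1%E.
Proof. exact: probability_setT. Qed.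

HB.instance Definition _ :=
  Kernel_isProbability.Build _ _ _ _ _ (prob_ker mk) prob_ker_prob.

End probability_kernel_of.

Lemma g_sigma_sub d (T : measurableType d) (G : set (set T)) :
  G `<=` measurable -> <<s G >> `<=` measurable.
Proof. by move=> GM; apply: smallest_sub => //; exact: sigma_algebra_measurable. Qed.

Lemma measurable_id_sub d (T : measurableType d) (G : set (set T)) :
  G `<=` measurable ->
  measurable_fun setT (id : T -> g_sigma_algebraType G).
Proof.
by move=> GM _ B mB; rewrite setTI; exact: (g_sigma_sub GM).
Qed.

(** The restriction of [mu] to [<<s G>>] is represented as a pushforward by the identity into
    [g_sigma_algebraType G]. *)
Lemma integral_sub d (T : measurableType d) (R : realType)
    (mu : {measure set T -> \bar R}) (G : set (set T)) (f : T -> \bar R)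
    (GM : G `<=` measurable) :
  (forall x, 0 <= f x)%E ->
  measurable_fun setT (f : g_sigma_algebraType G -> \bar R) ->
  (\int[pushforward mu (id : T -> g_sigma_algebraType G)]_x f x =
   \int[mu]_x f x)%E.
Proof.
move=> f0 mf; rewrite ge0_integral_pushforward //.
exact: measurable_id_sub.
Qed.

Lemma measurable_cond_law d (R : realType) (dO : measure_display)
    (Omega : measurableType dO) (P : probability Omega R)
    (G : set (set Omega)) (W : Omega -> 'cV[R]_d)
    (K : Omega -> probability (borelV R d) R) :
  is_cond_law P G W K -> forall U, measurable U ->
  measurable_fun [set: g_sigma_algebraType G] (K ^~ U).
Proof. by move=> KW U mU _ Y mY; rewrite setTI; exact: (KW U mU).1. Qed.

Lemma measurable_cond_mean d (R : realType) (dO : measure_display)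
    (Omega : measurableType dO) (P : probability Omega R)
    (G : set (set Omega)) (W : Omega -> 'cV[R]_d)
    (K : Omega -> probability (borelV R d) R)
    (g : Omega -> borelV R d -> \bar R) :
  is_cond_law P G W K -> (forall o y, 0 <= g o y)%E ->
  measurable_fun setT
    (fun z : g_sigma_algebraType G * borelV R d => g z.1 z.2) ->
  measurable_fun [set: g_sigma_algebraType G] (fun o => \int[K o]_y g o y)%E.
Proof.
move=> KW g0 mg.
exact: (@measurable_kfcomp _ _ (g_sigma_algebraType G) (borelV R d) R
  (prob_ker (measurable_cond_law KW)) (fun z => g z.1 z.2)).
Qed.

(** Freezing: [is_cond_law] is the disintegration hypothesis on rectangles for the joint law of [W]
    and the identity, the latter valued in [g_sigma_algebraType G]. A parameter measurable for
    [<<s G>>] may thus be held fixed while [W] is integrated. *)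
Lemma cond_law_integral d (R : realType) (dO : measure_display)
    (Omega : measurableType dO) (P : probability Omega R)
    (G : set (set Omega)) (W : Omega -> 'cV[R]_d)
    (K : Omega -> probability (borelV R d) R)
    (g : Omega -> borelV R d -> \bar R) :
  G `<=` measurable -> measurable_fun setT (W : Omega -> borelV R d) ->
  is_cond_law P G W K ->
  (forall o y, 0 <= g o y)%E ->
  measurable_fun setT
    (fun z : g_sigma_algebraType G * borelV R d => g z.1 z.2) ->
  (\int[P]_o g o (W o) = \int[P]_o \int[K o]_y g o y)%E.
Proof.
move=> GM mW KW g0 mg.
have mid := measurable_id_sub GM.
have mK := measurable_cond_law KW.
pose idm : {mfun Omega >-> g_sigma_algebraType G} :=
  HB.pack (id : Omega -> g_sigma_algebraType G)
    (isMeasurableFun.Build _ _ _ _ _ mid).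
have mp : measurable_fun setT
    (fun o => (o, W o) : g_sigma_algebraType G * borelV R d).
  exact: measurable_fun_pair.
pose nu := measure_function_pushforward__canonical__measure_function_Measure P mp.
have := @integral_disintegration _ _ _ _ _ (distribution P idm)
  (prob_ker mK) nu _ (fun z => g z.1 z.2).
rewrite /nu /= ge0_integral_pushforward //= => ->//; last first.
  move=> A B mA mB; have [mKB KB] := KW B mB.
  rewrite /pushforward -/(pushforward _ _).
  transitivity (P (A `&` W @^-1` B)); first by congr (P _).
  rewrite -KB //.
  rewrite ge0_integral_pushforward //.
  exact: (measurable_funS measurableT (@subsetT _ A) (mK B mB)).
rewrite integral_sub //.
  by move=> o; apply: integral_ge0.
exact: measurable_cond_mean KW g0 mg.
Qed.

Lemma integral_mrestr d (T : measurableType d) (R : realType)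
    (mu : {measure set T -> \bar R}) (A : set T) (mA : measurable A)
    (f : T -> \bar R) : (forall x, 0 <= f x)%E -> measurable_fun setT f ->
  (\int[mrestr mu mA]_x f x = \int[mu]_(x in A) f x)%E.
Proof.
move=> f0 mf; rewrite -(setUv A) ge0_integral_setU //; first last.
- exact/disj_setPCl.
- by rewrite setUv.
- exact: measurableC.
rewrite (_ : integral _ (~` A) _ = 0%E) ?adde0.
  apply: eq_measure_integral => B mB BA.
  by rewrite /= /mrestr setIidl.
have mAC : measurable (~` A) by exact: measurableC.
rewrite (@ge0_negligible_integral _ _ _ _ _ (~` A)) // ?setDv ?integral_set0 //.
  exact: measurable_funS mf.
by rewrite -[LHS]/(mu (~` A `&` A)) setICl measure0.
Qed.

(** On [<<s G>>] the restriction of [P] to [A] and the multiple of [P] by [c] are the same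
    measure. *)
Lemma integral_cond_prob (R : realType) (dO : measure_display)
    (Omega : measurableType dO) (P : probability Omega R)
    (G : set (set Omega)) (A : set Omega) (c : R) (Z : Omega -> \bar R) :
  G `<=` measurable -> measurable A -> 0 <= c ->
  (forall E, <<s G >> E -> P (E `&` A) = c%:E * P E)%E ->
  (forall o, 0 <= Z o)%E ->
  measurable_fun setT (Z : g_sigma_algebraType G -> \bar R) ->
  (\int[P]_(o in A) Z o = c%:E * \int[P]_o Z o)%E.
Proof.
move=> GM mA c0 PA Z0 mZ.
have mid := measurable_id_sub GM.
have mZO : measurable_fun setT Z by exact: (measurableT_comp mZ mid).
rewrite -(integral_mrestr P mA) //.
rewrite -(integral_sub (mrestr P mA) GM) //.
rewrite -(integral_sub P GM) //.
pose muG := measure_function_pushforward__canonical__measure_function_Measure P mid.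
rewrite -(@ge0_integral_mscale _ _ _ muG setT measurableT (NngNum c0)) //=.
apply: eq_measure_integral => E mE _ /=.
exact: PA.
Qed.

(** * Means of nonnegative functions and sub-Gaussian moments *)

Section mean.
Context d (T : measurableType d) (R : realType) (mu : {measure set T -> \bar R}).
Implicit Types (f g : T -> R) (a : R).

Local Notation EE f := (\int[mu]_y (f y)%:E)%E.

Lemma mean_ge0 f : (forall y, 0 <= f y) -> (0 <= EE f)%E.
Proof. by move=> f0; apply: integral_ge0 => y _; rewrite lee_fin. Qed.

Lemma le_mean f g : measurable_fun setT f -> measurable_fun setT g ->
  (forall y, 0 <= f y) -> (forall y, f y <= g y) -> (EE f <= EE g)%E.
Proof.
move=> mf mg f0 fg; apply: ge0_le_integral => //.
- by move=> y _; rewrite lee_fin.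
- exact/measurable_EFinP.
- exact/measurable_EFinP.
- by move=> y _; rewrite lee_fin.
Qed.

Lemma meanD f g : measurable_fun setT f -> measurable_fun setT g ->
  (forall y, 0 <= f y) -> (forall y, 0 <= g y) ->
  (EE (fun y => f y + g y) = EE f + EE g)%E.
Proof.
move=> mf mg f0 g0.
under eq_integral do rewrite EFinD.
rewrite ge0_integralD //.
- by move=> y _; rewrite lee_fin.
- exact/measurable_EFinP.
- by move=> y _; rewrite lee_fin.
- exact/measurable_EFinP.
Qed.

Lemma meanZ a f : measurable_fun setT f -> (forall y, 0 <= f y) -> 0 <= a ->
  (EE (fun y => (a * f y)%R) = a%:E * EE f)%E.
Proof.
move=> mf f0 a0.
under eq_integral do rewrite EFinM.
rewrite ge0_integralZl //.
- exact/measurable_EFinP.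
- by move=> y _; rewrite lee_fin.
Qed.

End mean.
Arguments le_mean {d T R mu f g}.
Arguments meanD {d T R mu f g}.
Arguments meanZ {d T R mu a f}.

Section subgaussian.
Context d (T : measurableType d) (R : realType) (mu : probability T R).
Implicit Types (f h : T -> R) (a c m s : R).

Local Notation EE f := (\int[mu]_y (f y)%:E)%E.

Lemma mean_cst a : EE (fun=> a) = a%:E.
Proof. by rewrite integral_cst //= probability_setT mule1. Qed.

Lemma mean_le_exp c f s h : 0 <= c ->
  measurable_fun setT f -> measurable_fun setT h ->
  (EE (fun y => expR (h y ^+ 2 / s ^+ 2)) <= 2%:E)%E ->
  (forall y, 0 <= f y) ->
  (forall y, f y <= c * expR (h y ^+ 2 / s ^+ 2)) ->
  (EE f <= (c * 2)%:E)%E.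
Proof.
move=> c0 mf mh h2 f0 fh.
have me : measurable_fun setT (fun y => expR (h y ^+ 2 / s ^+ 2)).
  apply: measurableT_comp => //; apply: measurable_funM => //.
  exact: measurable_funX.
apply: (@le_trans _ _ (EE (fun y => c * expR (h y ^+ 2 / s ^+ 2)))).
  apply: le_mean => //; exact: measurable_funM.
rewrite meanZ //.
by rewrite EFinM; apply: lee_wpmul2l; rewrite ?lee_fin.
Qed.

Lemma subgaussian_mean_norm s h : 0 < s -> measurable_fun setT h ->
  (EE (fun y => expR (h y ^+ 2 / s ^+ 2)) <= 2%:E)%E ->
  (EE (fun y => `|h y|) <= s%:E)%E.
Proof.
move=> s0 mh h2.
rewrite (_ : s = s / 2 * 2); last by field.
apply: (mean_le_exp _ _ mh h2) => [|||y].
- lra.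
- exact: measurableT_comp.
- by move=> y; exact: normr_ge0.
apply: (@le_trans _ _ (s / 2 * (1 + h y ^+ 2 / s ^+ 2))); last first.
  by rewrite ler_pM2l ?divr_gt0 // expR_ge1Dx.
rewrite -[h y ^+ 2]real_normK ?num_real //; move: `|h y| => x.
rewrite -subr_ge0 (_ : _ - _ = (s - x) ^+ 2 / (2 * s)); last by field; lra.
by rewrite divr_ge0 ?sqr_ge0 //; lra.
Qed.

Lemma subgaussian_mean_sqr s h : 0 < s -> measurable_fun setT h ->
  (EE (fun y => expR (h y ^+ 2 / s ^+ 2)) <= 2%:E)%E ->
  (EE (fun y => h y ^+ 2) <= (2 * s ^+ 2)%:E)%E.
Proof.
move=> s0 mh h2; rewrite mulrC.
apply: (mean_le_exp _ _ mh h2) => [|||y].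
- exact: sqr_ge0.
- exact: measurable_funX.
- by move=> y; exact: sqr_ge0.
apply: (@le_trans _ _ (s ^+ 2 * (1 + h y ^+ 2 / s ^+ 2))); last first.
  by rewrite ler_pM2l ?exprn_gt0 // expR_ge1Dx.
rewrite mulrDr mulr1 mulrCA divff ?mulr1 ?lerDr ?sqr_ge0 //.
by rewrite expf_neq0 //; lra.
Qed.

Lemma expR_ge_sqr (x : R) : 0 <= x -> x ^+ 2 <= 4 * expR x.
Proof.
move=> x0.
have : (1 + x / 2) ^+ 2 <= expR (x / 2) ^+ 2.
  by rewrite lerXn2r ?nnegrE ?expR_ge0 ?expR_ge1Dx //; lra.
have -> : expR x = expR (x / 2) ^+ 2 by rewrite expr2 -expRD; congr expR; field.
by move=> H; have := sqr_ge0 x; nra.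
Qed.

Lemma subgaussian_mean_pow4 s h : 0 < s -> measurable_fun setT h ->
  (EE (fun y => expR (h y ^+ 2 / s ^+ 2)) <= 2%:E)%E ->
  (EE (fun y => h y ^+ 4) <= (8 * s ^+ 4)%:E)%E.
Proof.
move=> s0 mh h2; rewrite (_ : 8 * s ^+ 4 = 4 * s ^+ 4 * 2); last by ring.
apply: (mean_le_exp _ _ mh h2) => [|||y].
- by rewrite mulr_ge0 // exprn_ge0 // ltW.
- exact: measurable_funX.
- by move=> y; rewrite exprn_even_ge0.
have := @expR_ge_sqr (h y ^+ 2 / s ^+ 2) ltac:(rewrite divr_ge0 ?sqr_ge0 //).
rewrite expr_div_n -!exprM ler_pdivrMr ?exprn_gt0 //; lra.
Qed.

(** For [|u| <= 1] the exponential is at most [(1 + |u|)^-1 <= 1 - |u| / 2] and [a u^2 <= |u| / 2].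
    Beyond, it is at most [2^-1], and expanding [(1 - a u^2)^2 >= 0] suffices. *)
Lemma expRN_norm_le (a u : R) : 0 <= a -> a <= 2^-1 ->
  expR (- `|u|) + a * u ^+ 2 <= 1 + a ^+ 2 / 2 * u ^+ 4.
Proof.
move=> a0 a1.
have eu : expR (- `|u|) * (1 + `|u|) <= 1.
  rewrite expRN mulrC ler_pdivrMr ?expR_gt0 // mul1r.
  exact: expR_ge1Dx.
rewrite -[u ^+ 2]real_normK ?num_real //.
rewrite (_ : u ^+ 4 = `|u| ^+ 4); last first.
  by rewrite -[4%N]/(2 * 2)%N !exprM real_normK ?num_real.
have := expR_ge0 (- `|u|); have := normr_ge0 u.
move: (expR _) eu => e eu; move: `|u| eu => x eu x0 e0.
have [x1|x1] := leP x 1.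
  have : 0 <= a ^+ 2 / 2 * x ^+ 4 by rewrite mulr_ge0 ?divr_ge0 ?exprn_ge0.
  have : a * x ^+ 2 <= 2^-1 * x by nra.
  have : e <= 1 - x / 2 by nra.
  lra.
have e2 : e <= 2^-1 by nra.
have := sqr_ge0 (1 - a * x ^+ 2); nra.
Qed.

(* A Paley-Zygmund bound in exponential form: the inequality of
   [expRN_norm_le] is integrated with [a] of the order of
   [E u ^ 2 / E u ^ 4], for [u = (m + h) / l]. The two cases keep it uniform in
   the shift [m]. *)
Lemma subgaussian_shift_expR (m l s : R) h : 0 < l -> l <= s ->
  measurable_fun setT h ->
  (EE (fun y => expR (h y ^+ 2 / s ^+ 2)) <= 2%:E)%E ->
  ((l ^+ 2)%:E <= EE (fun y => (m + h y) ^+ 2)%R)%E ->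
  (EE (fun y => expR (- `|(m + h y) / l|)) <=
     (1 - l ^+ 4 / (1152 * s ^+ 4))%:E)%E.
Proof.
move=> l0 ls mh h2 hl.
have s0 : 0 < s by exact: lt_le_trans ls.
have mY : measurable_fun setT (fun y => m + h y) by exact: measurable_funD.
have mu_ : measurable_fun setT (fun y => (m + h y) / l).
  exact: measurable_funM.
have me : measurable_fun setT (fun y => expR (- `|(m + h y) / l|)).
  apply: measurableT_comp => //; apply: measurableT_comp => //.
  exact: measurableT_comp.
have H2 := subgaussian_mean_sqr s0 mh h2.
have H4 := subgaussian_mean_pow4 s0 mh h2.
set M1 := EE (fun y => expR (- `|(m + h y) / l|)).
set M2 := EE (fun y => (m + h y) ^+ 2).
set M4 := EE (fun y => (m + h y) ^+ 4).
have M4le : (M4 <= (8 * m ^+ 4 + 64 * s ^+ 4)%:E)%E.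
  apply: (@le_trans _ _ (EE (fun y => 8 * m ^+ 4 + 8 * h y ^+ 4))).
    apply: le_mean.
    - exact: measurable_funX.
    - apply: measurable_funD => //; apply: measurable_funM => //.
      exact: measurable_funX.
    - by move=> y; rewrite exprn_even_ge0.
    - move=> y; have := sqr_ge0 (m - h y); have := sqr_ge0 (m + h y).
      have := sqr_ge0 (m ^+ 2 - h y ^+ 2); nra.
  rewrite meanD //; last 3 first.
  - by apply: measurable_funM => //; exact: measurable_funX.
  - by move=> y; rewrite mulr_ge0 // exprn_even_ge0.
  - by move=> y; rewrite mulr_ge0 // exprn_even_ge0.
  rewrite mean_cst meanZ //; last 2 first.
  - exact: measurable_funX.
  - by move=> y; rewrite exprn_even_ge0.
  rewrite (_ : 64 * s ^+ 4 = 8 * (8 * s ^+ 4)); last by ring.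
  by rewrite [leRHS]EFinD; apply: leeD2l; rewrite [leRHS]EFinM; apply: lee_wpmul2l;
    rewrite ?lee_fin.
have M2le : ((m ^+ 2 / 2)%:E <= M2 + (2 * s ^+ 2)%:E)%E.
  apply: (@le_trans _ _ (M2 + EE (fun y => (h y ^+ 2)%R))%E); last exact: leeD2l.
  rewrite -meanD; last 4 first.
  - exact: measurable_funX.
  - exact: measurable_funX.
  - by move=> y; rewrite sqr_ge0.
  - by move=> y; rewrite sqr_ge0.
  rewrite -mean_cst; apply: le_mean => //.
  - by apply: measurable_funD; exact: measurable_funX.
  - by move=> y; rewrite divr_ge0 ?sqr_ge0.
  - by move=> y; have := sqr_ge0 (m + 2 * h y); nra.
have M1ge0 : (0 <= M1)%E by apply: mean_ge0 => y; exact: expR_ge0.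
have M2ge0 : (0 <= M2)%E by apply: mean_ge0 => y; exact: sqr_ge0.
have M4ge0 : (0 <= M4)%E by apply: mean_ge0 => y; rewrite exprn_even_ge0.
have key a : 0 < a -> a <= 2^-1 ->
    (M1 + (a / l ^+ 2)%:E * M2 <= 1 + (a ^+ 2 / 2 / l ^+ 4)%:E * M4)%E.
  move=> a0 a1.
  have al : 0 <= a / l ^+ 2 by rewrite divr_ge0 ?exprn_ge0 // ltW.
  have al4 : 0 <= a ^+ 2 / 2 / l ^+ 4 by rewrite !divr_ge0 ?exprn_ge0 // ltW.
  have mY2 : measurable_fun setT (fun y => (m + h y) ^+ 2) by exact: measurable_funX.
  have mY4 : measurable_fun setT (fun y => (m + h y) ^+ 4) by exact: measurable_funX.
  have Y2 y : 0 <= (m + h y) ^+ 2 by exact: sqr_ge0.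
  have Y4 y : 0 <= (m + h y) ^+ 4 by rewrite exprn_even_ge0.
  have maY2 : measurable_fun setT (fun y => a / l ^+ 2 * (m + h y) ^+ 2).
    exact: measurable_funM.
  have maY4 : measurable_fun setT (fun y => a ^+ 2 / 2 / l ^+ 4 * (m + h y) ^+ 4).
    exact: measurable_funM.
  have aY2 y : 0 <= a / l ^+ 2 * (m + h y) ^+ 2 by rewrite mulr_ge0.
  have aY4 y : 0 <= a ^+ 2 / 2 / l ^+ 4 * (m + h y) ^+ 4 by rewrite mulr_ge0.
  have e0 y : 0 <= expR (- `|(m + h y) / l|) by exact: expR_ge0.
  rewrite -(meanZ mY2 Y2 al) -(meanZ mY4 Y4 al4) -(mean_cst 1).
  rewrite -(meanD me maY2 e0 aY2) -(meanD _ maY4 _ aY4) //.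
  apply: le_mean.
  - exact: measurable_funD.
  - exact: measurable_funD.
  - by move=> y; exact: addr_ge0.
  - move=> y; have := expRN_norm_le ((m + h y) / l) (ltW a0) a1.
    rewrite !expr_div_n -subr_ge0 => H; rewrite -subr_ge0.
    by apply: le_trans H _; rewrite [leRHS](_ : _ =
      1 + a ^+ 2 / 2 * ((m + h y) ^+ 4 / l ^+ 4)
      - (expR (- `|(m + h y) / l|) + a * ((m + h y) ^+ 2 / l ^+ 2))) //; ring.
have M4fin : M4 \is a fin_num.
  by rewrite ge0_fin_numE // (le_lt_trans M4le) // ltry.
have l4 : 0 < l ^+ 4 by rewrite exprn_gt0.
have s4 : 0 < s ^+ 4 by rewrite exprn_gt0.
have l2 : 0 < l ^+ 2 by rewrite exprn_gt0.
have s2 : 0 < s ^+ 2 by rewrite exprn_gt0.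
have ls2 : l ^+ 2 <= s ^+ 2 by rewrite lerXn2r ?nnegrE // ltW.
have ls4 : l ^+ 4 <= s ^+ 4 by rewrite lerXn2r ?nnegrE // ltW.
have M1fin : M1 \is a fin_num.
  rewrite ge0_fin_numE // (@le_lt_trans _ _ (EE (fun=> 1))) //.
    by apply: le_mean => // y; rewrite -expR0 ler_expR oppr_le0.
  by rewrite mean_cst ltry.
(* Finiteness of [M2] comes from [key] itself at [a = 2^-1], since [M1] and [M4] are finite. *)
have M2fin : M2 \is a fin_num.
  have := key 2^-1 ltac:(lra) (lexx _).
  rewrite -(fineK M1fin) -(fineK M4fin) ge0_fin_numE //.
  case: (M2) => [r2| |] //; first by rewrite ltry.
  by rewrite gt0_muley // lte_fin divr_gt0.
move: key M2le M4le hl; rewrite -/M2.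
rewrite -(fineK M1fin) -(fineK M2fin) -(fineK M4fin).
move: (fine M1) (fine M2) (fine M4) => r1 r2 r4 key.
rewrite -EFinD !lee_fin => M2le M4le hl.
have {}key a : 0 < a -> a <= 2^-1 ->
    r1 <= 1 - a * (r2 / l ^+ 2) + a ^+ 2 / 2 * (r4 / l ^+ 4).
  move=> a0 a1; have := key a a0 a1.
  rewrite -!EFinM -!EFinD lee_fin.
  have -> : a * (r2 / l ^+ 2) = a / l ^+ 2 * r2 by ring.
  have -> : a ^+ 2 / 2 * (r4 / l ^+ 4) = a ^+ 2 / 2 / l ^+ 4 * r4 by ring.
  lra.
(* Minimising over [a] suggests [a = l^2 M2 / M4]. For a large shift, [M2 >= m^2 / 4] and
   [M4 <= 9 m^4] lead to [a = l^2 / (36 m^2)] and to a gain of at least [1/144 - 1/288], free of [l]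
   and [m]. *)
have [ms|ms] := leP (8 * s ^+ 2) (m ^+ 2).
  have m2 : 0 < m ^+ 2 by apply: lt_le_trans ms; rewrite mulr_gt0.
  have m4E : m ^+ 4 = (m ^+ 2) ^+ 2 by rewrite -exprM.
  have s4E : s ^+ 4 = (s ^+ 2) ^+ 2 by rewrite -exprM.
  have l4E : l ^+ 4 = (l ^+ 2) ^+ 2 by rewrite -exprM.
  have mn0 : m != 0 by apply: contraTneq m2 => ->; rewrite expr0n ltxx.
  have m36 : 0 < 36 * m ^+ 2 by lra.
  have a0 : 0 < l ^+ 2 / (36 * m ^+ 2) by exact: divr_gt0.
  have a1 : l ^+ 2 / (36 * m ^+ 2) <= 2^-1.
    by rewrite ler_pdivrMr //; lra.
  apply: (le_trans (key _ a0 a1)).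
  have r2m : m ^+ 2 / 4 <= r2 by lra.
  have r4m : r4 <= 9 * m ^+ 4 by nra.
  have -> : l ^+ 2 / (36 * m ^+ 2) * (r2 / l ^+ 2) = r2 / (36 * m ^+ 2).
    by field; rewrite mn0; lra.
  have -> : (l ^+ 2 / (36 * m ^+ 2)) ^+ 2 / 2 * (r4 / l ^+ 4) =
      r4 / (2592 * m ^+ 4).
    by field; rewrite mn0; lra.
  have : 144^-1 <= r2 / (36 * m ^+ 2) by rewrite ler_pdivlMr //; lra.
  have : r4 / (2592 * m ^+ 4) <= 288^-1.
    by rewrite ler_pdivrMr; nra.
  have : l ^+ 4 / (1152 * s ^+ 4) <= 1152^-1.
    by rewrite ler_pdivrMr; lra.
  lra.
(* For a moderate shift, [M4 <= (8 * 64 + 64) s^4 = 576 s^4] and [M2 >= l^2] lead to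
   [a = l^4 / (576 s^4)]; the gain is [a / 2], hence 1152. *)
have m4 : m ^+ 4 <= 64 * s ^+ 4.
  have := sqr_ge0 m; rewrite -[m ^+ 4]/(m ^+ (2 * 2)) exprM.
  rewrite -[s ^+ 4]/(s ^+ (2 * 2)) exprM; nra.
have a0 : 0 < l ^+ 4 / (576 * s ^+ 4) by apply: divr_gt0; lra.
have a1 : l ^+ 4 / (576 * s ^+ 4) <= 2^-1.
  by rewrite ler_pdivrMr; lra.
apply: (le_trans (key _ a0 a1)).
have : 1 <= r2 / l ^+ 2 by rewrite ler_pdivlMr // mul1r.
have : r4 / l ^+ 4 <= 576 * s ^+ 4 / l ^+ 4 by rewrite ler_pM2r ?invr_gt0 //; lra.
have -> : l ^+ 4 / (1152 * s ^+ 4) = l ^+ 4 / (576 * s ^+ 4) / 2.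
  by field; lra.
have aE : l ^+ 4 / (576 * s ^+ 4) * (576 * s ^+ 4 / l ^+ 4) = 1 by field; lra.
move: (l ^+ 4 / (576 * s ^+ 4)) (576 * s ^+ 4 / l ^+ 4) a0 aE => a b a0 ab.
move: (r4 / l ^+ 4) (r2 / l ^+ 2) => c4 c2 h4 h2'.
have : a ^+ 2 / 2 * c4 <= a / 2.
  have -> : a / 2 = a ^+ 2 / 2 * b.
    transitivity (a / 2 * (a * b)); [by rewrite ab mulr1|ring].
  by rewrite ler_pM2l //; nra.
have : a <= a * c2 by rewrite ler_peMr // ltW.
lra.
Qed.

End subgaussian.

(** * Euclidean geometry and the operator norm *)

Section euclid.
Context (R : realType) (d : nat).
Implicit Types (u v x y : 'cV[R]_d) (A : 'M[R]_d).

Lemma dotvC u v : dotv u v = dotv v u.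
Proof. by apply: eq_bigr => i _; rewrite mulrC. Qed.

Lemma dotvDl u v x : dotv (u + v) x = dotv u x + dotv v x.
Proof. by rewrite -big_split; apply: eq_bigr => i _; rewrite mxE mulrDl. Qed.

Lemma dotvZl c u x : dotv (c *: u) x = c * dotv u x.
Proof. by rewrite mulr_sumr; apply: eq_bigr => i _; rewrite mxE mulrA. Qed.

Lemma dotvDr u v x : dotv x (u + v) = dotv x u + dotv x v.
Proof. by rewrite !(dotvC x) dotvDl. Qed.

Lemma dotvZr c u x : dotv x (c *: u) = c * dotv x u.
Proof. by rewrite !(dotvC x) dotvZl. Qed.

Lemma dotvBr u v x : dotv x (u - v) = dotv x u - dotv x v.
Proof. by rewrite dotvDr -scaleN1r dotvZr mulN1r. Qed.

Lemma dotv0l v : dotv 0 v = 0.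
Proof. by rewrite -(scale0r 0) dotvZl mul0r. Qed.

Lemma dotv_mulmxl A x v : dotv (A *m x) v = dotv x (A^T *m v).
Proof.
rewrite /dotv; under eq_bigr do rewrite mxE mulr_suml.
rewrite exchange_big; apply: eq_bigr => j _ /=.
rewrite mxE mulr_sumr; apply: eq_bigr => i _; rewrite mxE; ring.
Qed.

Lemma dotv_delta v i : dotv v (delta_mx i 0) = v i 0.
Proof.
rewrite /dotv (bigD1 i) //= mxE !eqxx mulr1 big1 ?addr0 // => j ji.
by rewrite mxE (negPf ji) mulr0.
Qed.

Lemma dotv_sqr v : dotv v v = \sum_i v i 0 ^+ 2.
Proof. by apply: eq_bigr => i _; rewrite expr2. Qed.

Lemma dotv_ge0 v : 0 <= dotv v v.
Proof. by rewrite dotv_sqr sumr_ge0 // => i _; rewrite sqr_ge0. Qed.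

Lemma l2norm_ge0 v : 0 <= l2norm v.
Proof. exact: sqrtr_ge0. Qed.

Lemma l2norm_sqr v : l2norm v ^+ 2 = dotv v v.
Proof. by rewrite /l2norm -dotv_sqr sqr_sqrtr // dotv_ge0. Qed.

Lemma dotv_eq0 v : dotv v v = 0 -> v = 0.
Proof.
move=> /eqP; rewrite dotv_sqr psumr_eq0 => [/allP v0|i _]; last exact: sqr_ge0.
apply/colP => i; rewrite mxE; apply/eqP.
by have := v0 i (mem_index_enum _); rewrite sqrf_eq0.
Qed.

Lemma l2norm_eq0 v : l2norm v = 0 -> v = 0.
Proof. by move=> v0; apply: dotv_eq0; rewrite -l2norm_sqr v0 expr0n. Qed.

Lemma l2norm_gt0 v : v != 0 -> 0 < l2norm v.
Proof.
rewrite lt0r l2norm_ge0 andbT; apply: contraNneq => v0.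
by rewrite (l2norm_eq0 v0).
Qed.

Lemma l2normZ c v : l2norm (c *: v) = `|c| * l2norm v.
Proof.
apply/eqP; rewrite -(@eqrXn2 _ 2) ?mulr_ge0 ?l2norm_ge0 //.
by rewrite exprMn real_normK ?num_real // !l2norm_sqr dotvZl dotvZr mulrA expr2.
Qed.

Lemma cauchy_schwarz u v : `|dotv u v| <= l2norm u * l2norm v.
Proof.
rewrite -ler_sqr ?nnegrE ?mulr_ge0 ?l2norm_ge0 ?normr_ge0 //.
rewrite real_normK ?num_real // exprMn !l2norm_sqr.
have [v0|v0] := eqVneq (dotv v v) 0.
  by rewrite (dotv_eq0 v0) dotvC dotv0l expr0n /= mulr_ge0 // dotv_ge0.
have vp : 0 < dotv v v by rewrite lt0r v0 dotv_ge0.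
rewrite -subr_ge0 -(pmulr_rge0 _ vp).
have := dotv_ge0 (dotv v v *: u + (- dotv u v) *: v).
rewrite !(dotvDl, dotvDr, dotvZl, dotvZr) (dotvC v u).
by move=> /le_trans; apply; rewrite le_eqVlt; apply/orP; left; apply/eqP; ring.
Qed.

Lemma l2norm_triangle u v : l2norm (u + v) <= l2norm u + l2norm v.
Proof.
rewrite -ler_sqr ?nnegrE ?addr_ge0 ?l2norm_ge0 //.
rewrite l2norm_sqr dotvDl !dotvDr (dotvC v u) sqrrD !l2norm_sqr.
have := le_trans (ler_norm _) (cauchy_schwarz u v); lra.
Qed.

Lemma l2norm_le_sum v : l2norm v <= \sum_i `|v i 0|.
Proof.
rewrite -ler_sqr ?nnegrE ?l2norm_ge0 ?sumr_ge0 //.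
rewrite l2norm_sqr dotv_sqr expr2 mulr_suml ler_sum // => i _.
rewrite -real_normK ?num_real // expr2 ler_wpM2l // (bigD1 i) //= lerDl.
exact: sumr_ge0.
Qed.

Lemma l2norm0 : l2norm (0 : 'cV[R]_d) = 0.
Proof. by rewrite -(scale0r 0) l2normZ normr0 mul0r. Qed.

(** The real [sup] takes a default value on an unbounded set, so the supremum in [opnorm] has to be
    justified; Cauchy-Schwarz on each row gives an upper bound. *)
Lemma opnorm_has_sup A :
  has_sup [set l2norm (A *m v) | v in [set v : 'cV[R]_d | l2norm v <= 1]].
Proof.
split; first by exists (l2norm (A *m 0)), 0 => //=; rewrite l2norm0.
exists (\sum_i l2norm (row i A)^T) => _ [v /= v1 <-].
apply: le_trans (l2norm_le_sum _) _; apply: ler_sum => i _.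
rewrite (_ : (A *m v) i 0 = dotv (row i A)^T v).
  apply: le_trans (cauchy_schwarz _ _) _.
  by rewrite ler_piMr // l2norm_ge0.
by rewrite mxE; apply: eq_bigr => j _; rewrite !mxE.
Qed.

Lemma opnorm_ge0 A : 0 <= opnorm A.
Proof.
apply: (@le_trans _ _ (l2norm (A *m (0 : 'cV[R]_d)))); first exact: l2norm_ge0.
apply: ub_le_sup; first exact: (opnorm_has_sup A).2.
by exists 0 => //=; rewrite l2norm0.
Qed.

Lemma l2norm_mulmx A v : l2norm (A *m v) <= opnorm A * l2norm v.
Proof.
have [->|v0] := eqVneq v 0; first by rewrite mulmx0 l2norm0 mulr0.
have vp := l2norm_gt0 v0.
rewrite -ler_pdivrMr // mulrC -[(l2norm v)^-1]ger0_norm ?invr_ge0 ?l2norm_ge0 //.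
rewrite -l2normZ scalemxAr; apply: ub_le_sup.
  exact: (opnorm_has_sup A).2.
exists ((l2norm v)^-1 *: v) => //=.
by rewrite l2normZ ger0_norm ?invr_ge0 ?l2norm_ge0 // mulVf ?gt_eqF.
Qed.

(** [|A^T v|^2 = (A A^T v) . v] is at most [opnorm A * |A^T v| * |v|] by Cauchy-Schwarz, and one
    factor cancels. *)
Lemma l2norm_trmx A v : l2norm (A^T *m v) <= opnorm A * l2norm v.
Proof.
have [->|v0] := eqVneq (A^T *m v) 0.
  by rewrite l2norm0 mulr_ge0 ?opnorm_ge0 ?l2norm_ge0.
rewrite -(ler_pM2l (l2norm_gt0 v0)) -expr2 l2norm_sqr -dotv_mulmxl.
apply: le_trans (ler_norm _) _; apply: le_trans (cauchy_schwarz _ _) _.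
rewrite mulrA [l2norm (A^T *m v) * _]mulrC ler_wpM2r ?l2norm_ge0 //.
exact: l2norm_mulmx.
Qed.

End euclid.

(** * The quadratic Lyapunov function *)

Section lyapunov.
Context (R : realType) (d : nat) (A B : 'M[R]_d) (b : R).
Hypotheses (b0 : 0 < b) (b1 : b < 1) (AB : A^T = b *: B).
Implicit Types (v x y : 'cV[R]_d).

(** Unfolded, this is [1 - b] times the sum over [j < n] of [b^j (x . B^j v)^2], with weights adding
    up to at most 1. The level [n] counts the steps left before the horizon: each step of the
    dynamics uses up one level, so no infinite series is involved. *)
Fixpoint lyap n v x : R :=
  if n is n'.+1 then (1 - b) * dotv x v ^+ 2 + b * lyap n' (B *m v) x else 0.

Lemma lyap_ge0 n v x : 0 <= lyap n v x.
Proof.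
elim: n v => //= n IH v; apply: addr_ge0; apply: mulr_ge0 => //.
- by rewrite subr_ge0 ltW.
- exact: sqr_ge0.
- exact: ltW.
Qed.

Lemma lyap_mulmx n v x : lyap n v (A *m x) = b ^+ 2 * lyap n (B *m v) x.
Proof.
elim: n v => /= [|n IH] v; first by rewrite mulr0.
by rewrite IH dotv_mulmxl AB -scalemxAl dotvZr; ring.
Qed.

(** Convexity of the square: [(a + c)^2 <= a^2 / b + c^2 / (1 - b)]. The loss [b^-1], set against
    the factor [b^2] of [lyap_mulmx], leaves exactly the weight [b] of the recursion. *)
Lemma lyapD n v x y :
  lyap n v (x + y) <= b^-1 * lyap n v x + (1 - b)^-1 * lyap n v y.
Proof.
elim: n v => /= [|n IH] v; first by rewrite !mulr0 addr0.
rewrite dotvDl; move: (dotv x v) (dotv y v) (IH (B *m v)) => a c.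
move: (lyap _ _ _) (lyap n _ x) (lyap n _ y) => p q r H.
have : (a + c) ^+ 2 <= b^-1 * a ^+ 2 + (1 - b)^-1 * c ^+ 2.
  rewrite -subr_ge0 (_ : _ - _ = ((1 - b) * a - b * c) ^+ 2 / (b * (1 - b))).
    by apply: divr_ge0; rewrite ?sqr_ge0 // mulr_ge0 // ltW // subr_gt0.
  by field; rewrite !gt_eqF ?subr_gt0.
have b1' : 0 < 1 - b by rewrite subr_gt0.
move=> /(ler_wpM2l (ltW b1')) H1; move: H => /(ler_wpM2l (ltW b0)) H2.
apply: le_trans (lerD H1 H2) _; rewrite le_eqVlt; apply/orP; left; apply/eqP.
by field; rewrite !gt_eqF.
Qed.

Lemma lyap_step n v x y :
  (1 - b) * dotv x v ^+ 2 + lyap n v (A *m x + y) <=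
  lyap n.+1 v x + (1 - b)^-1 * lyap n v y.
Proof.
have := lyapD n v (A *m x) y; rewrite lyap_mulmx /= expr2 !mulrA mulVf ?gt_eqF //.
rewrite mul1r; lra.
Qed.

Lemma lyap_sum (x w : nat -> 'cV[R]_d) T v :
  (forall t, (t < T)%N -> x t.+1 = A *m x t + w t) ->
  (1 - b) ^+ 2 * \sum_(t < T) dotv (x t) v ^+ 2 <=
  lyap T v (x 0%N) + \sum_(t < T) lyap (T - t.+1) v (w t).
Proof.
move=> dyn.
(* Telescoping of [lyap_step], with level [T - n] at time [n]. One factor [1 - b] comes from the
   step; the other clears [(1 - b)^-1] in front of the disturbances. *)
suff H n : (n <= T)%N -> (1 - b) * \sum_(t < n) dotv (x t) v ^+ 2 +
    lyap (T - n) v (x n) <= lyap T v (x 0%N) +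
    (1 - b)^-1 * \sum_(t < n) lyap (T - t.+1) v (w t).
  have := H T (leqnn T); rewrite subnn /= addr0.
  have b1' : 0 < 1 - b by rewrite subr_gt0.
  move=> /(ler_wpM2l (ltW b1')).
  rewrite mulrA -expr2 mulrDr mulrA divff ?mul1r ?gt_eqF //.
  have := lyap_ge0 T v (x 0%N); move: (lyap _ _ _) => g g0.
  move=> /le_trans; apply; rewrite lerD2r; by apply: ler_piMl => //; rewrite lerBlDr lerDl ltW.
elim: n => [_|n IH nT]; first by rewrite !big_ord0 !mulr0 add0r addr0 subn0.
have := IH (ltnW nT); have := lyap_step (T - n.+1) v (x n) (w n).
rewrite -(dyn n nT) -subSn // subSS !big_ord_recr /=; lra.
Qed.

End lyapunov.

(** * Deterministic analysis of one trajectory *)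

Section path.
Context (R : realType) (d : nat).
Implicit Types (v y : 'cV[R]_d) (A M : 'M[R]_d) (x w : nat -> 'cV[R]_d).

Definition calm_sign y : R := if y == 0 then 1 else - 1.

Definition signed_sum T x w v : R :=
  \sum_(t < T) calm_sign (w t) * `|dotv (x t) v|.

Lemma signed_sumZ T x w c v :
  signed_sum T x w (c *: v) = `|c| * signed_sum T x w v.
Proof.
rewrite mulr_sumr; apply: eq_bigr => t _.
by rewrite dotvZr normrM; ring.
Qed.

Lemma mulmx_dotv A y i : (A *m y) i 0 = dotv y (row i A)^T.
Proof. by rewrite mxE; apply: eq_bigr => j _; rewrite !mxE mulrC. Qed.

(** The l1 norm decouples the rows. If [e] is the [i]-th entry of [(M - A) x_t], a calm step adds
    exactly [|e|] to the excess of the objective, and an attack at least [- |e|] by the triangle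
    inequality, whatever the disturbance. *)
Lemma signed_sum_unique_minimizer T x w A :
  (forall t, (t < T)%N -> x t.+1 = A *m x t + w t) ->
  (forall v, v != 0 -> 0 < signed_sum T x w v) ->
  unique_minimizer (l1_objective T x) A.
Proof.
move=> dyn F0.
have F0' v : 0 <= signed_sum T x w v.
  have [->|/F0/ltW //] := eqVneq v 0.
  by rewrite /signed_sum big1 // => t _; rewrite dotvC dotv0l normr0 mulr0.
have gap M : l1_objective T x A + \sum_i signed_sum T x w (row i (M - A))^T <=
    l1_objective T x M.
  rewrite /l1_objective /signed_sum [X in _ + X]exchange_big -big_split /=.
  apply: ler_sum => t _; rewrite /l1norm -big_split /=; apply: ler_sum => i _.
  rewrite dyn // [A *m x t + w t - A *m x t]addrAC subrr add0r.
  rewrite (_ : A *m x t + w t - M *m x t = w t - (M - A) *m x t); last first.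
    by rewrite mulmxBl opprB addrA [w t + _]addrC.
  rewrite [(w t - _) i 0]mxE [(- (_ *m _)) i 0]mxE mulmx_dotv.
  move: (dotv _ _) => e; rewrite /calm_sign; have [->|_] := eqVneq (w t) 0.
    by rewrite mxE normr0 add0r mul1r sub0r normrN.
  rewrite mulN1r; have := ler_normD (w t i 0 - e) e; rewrite subrK; lra.
split=> [M|M Mmin].
  by apply: le_trans (gap M); rewrite lerDl sumr_ge0.
apply/eqP; apply: contraT => MA.
have [i Mi] : exists i, (row i (M - A))^T != 0.
  apply/existsP; apply: contraT; rewrite negb_exists => /forallP Mi.
  case/negP: MA; rewrite -subr_eq0; apply/eqP/row_matrixP => i.
  by have /negPn/eqP/(congr1 trmx) := Mi i; rewrite trmxK trmx0 row0.
have := gap M; have := Mmin A; rewrite (bigD1 i) //= => H1 H2.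
have := F0 _ Mi.
have : 0 <= \sum_(j | j != i) signed_sum T x w (row j (M - A))^T by exact: sumr_ge0.
lra.
Qed.

Lemma sum_l2norm T x w A : opnorm A <= 1 ->
  (forall t, (t < T)%N -> x t.+1 = A *m x t + w t) ->
  (1 - opnorm A) * \sum_(t < T) l2norm (x t) <=
  l2norm (x 0%N) + \sum_(t < T) l2norm (w t).
Proof.
move=> A1 dyn.
suff H n : (n <= T)%N -> (1 - opnorm A) * \sum_(t < n) l2norm (x t) +
    l2norm (x n) <= l2norm (x 0%N) + \sum_(t < n) l2norm (w t).
  by have := H T (leqnn T); have := l2norm_ge0 (x T); lra.
elim: n => [_|n IH nT]; first by rewrite !big_ord0 mulr0 add0r addr0.
have := IH (ltnW nT); rewrite !big_ord_recr /= dyn //.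
have := l2norm_triangle (A *m x n) (w n); have := l2norm_mulmx A (x n); lra.
Qed.

(** Lattice of mesh [m^-1] in the cube [[-1, 1]^d]. Indexing by a finite type makes the union bound
    a finite sum; points of unsuitable norm stay in the index set and receive weight 0 later. *)
Definition grid (m : nat) (k : {ffun 'I_d -> 'I_(2 * m).+1}) : 'cV[R]_d :=
  \col_i ((k i)%:R / m%:R - 1).

Lemma grid_approx m v : (0 < m)%N -> (forall i, `|v i 0| <= 2^-1) ->
  exists k : {ffun 'I_d -> 'I_(2 * m).+1}, l2norm (v - grid k) <= d%:R / m%:R.
Proof.
move=> m0 v1; have m0' : 0 < m%:R :> R by rewrite ltr0n.
pose a i := m%:R * (v i 0 + 1).
have aP i : (Num.truncn (a i))%:R <= a i < (Num.truncn (a i)).+1%:R.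
  apply: truncn_itv; rewrite mulr_ge0 // ?ler0n //.
  have := v1 i; rewrite ler_norml => /andP[]; lra.
have am i : (Num.truncn (a i) < (2 * m).+1)%N.
  rewrite ltnS -(ler_nat R); have /andP[+ _] := aP i => /le_trans; apply.
  rewrite natrM [leRHS]mulrC /a ler_pM2l //.
  have := v1 i; rewrite ler_norml => /andP[]; lra.
exists [ffun i => inord (Num.truncn (a i))].
apply: le_trans (l2norm_le_sum _) _.
rewrite -[d in d%:R]card_ord -sumr_const mulr_suml; apply: ler_sum => i _.
rewrite !mxE ffunE inordK // mul1r.
have -> : v i 0 - ((Num.truncn (a i))%:R / m%:R - 1) =
    (a i - (Num.truncn (a i))%:R) / m%:R by rewrite /a; field; lra.
rewrite normrM [`|m%:R^-1|]ger0_norm ?invr_ge0 ?ler0n // ger0_norm; last first.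
  by rewrite subr_ge0; case/andP: (aP i).
rewrite ler_piMl ?invr_ge0 ?ler0n //.
by have /andP[_ ] := aP i; rewrite -natr1; lra.
Qed.

(* Coordinates of a vector of norm 1/2 stay in the range of the grid after
   rounding, and the rounded vector keeps a norm between 1/4 and 1. *)
Lemma signed_sum_grid T x w m (c S : R) : (0 < m)%N ->
  d%:R / m%:R <= 4^-1 :> R -> \sum_(t < T) l2norm (x t) <= S ->
  d%:R / m%:R * S < c ->
  (forall k : {ffun 'I_d -> 'I_(2 * m).+1}, 4^-1 <= l2norm (grid k : 'cV[R]_d) ->
    l2norm (grid k : 'cV[R]_d) <= 1 -> c <= signed_sum T x w (grid k)) ->
  forall v, v != 0 -> 0 < signed_sum T x w v.
Proof.
move=> m0 dm xS Sc Fc v v0.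
have vp := l2norm_gt0 v0.
set a := (2 * l2norm v)^-1.
have a0 : 0 < a by rewrite invr_gt0; lra.
have av : l2norm (a *: v) = 2^-1.
  by rewrite l2normZ gtr0_norm // /a; field; lra.
rewrite -(pmulr_rgt0 _ a0) -[a]gtr0_norm // -signed_sumZ.
move: (a *: v) av => u u2 {a a0}.
have [k uk] : exists k : {ffun 'I_d -> 'I_(2 * m).+1}, l2norm (u - grid k) <= d%:R / m%:R.
  apply: grid_approx => // i; rewrite -u2 -(dotv_delta u).
  apply: le_trans (cauchy_schwarz _ _) _.
  rewrite [l2norm (delta_mx i 0)](_ : _ = 1) ?mulr1 //.
  apply/eqP; rewrite -(@eqrXn2 _ 2) ?l2norm_ge0 // l2norm_sqr dotv_delta mxE.
  by rewrite !eqxx expr1n.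
have := Fc k; move: (grid k) uk => g uk.
have gu := l2norm_triangle (u - g) g; rewrite subrK in gu.
have ug : l2norm g <= l2norm (u - g) + l2norm u.
  have := l2norm_triangle (- 1 *: (u - g)) u.
  by rewrite l2normZ normrN normr1 mul1r scaleN1r opprB subrK.
move=> /(_ ltac:(lra)) /(_ ltac:(lra)) cg.
(* [signed_sum] is Lipschitz in the direction, with constant the sum of the [|x_t|]; a fine mesh
   keeps the rounding error below the margin [c]. *)
have : signed_sum T x w g - signed_sum T x w u <= d%:R / m%:R * S.
  apply: (@le_trans _ _ (\sum_(t < T) d%:R / m%:R * l2norm (x t))); last first.
    by rewrite -mulr_sumr ler_wpM2l // divr_ge0 ?ler0n.
  rewrite -sumrB; apply: ler_sum => t _.
  apply: (@le_trans _ _ `|dotv (x t) (u - g)|); last first.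
    apply: le_trans (cauchy_schwarz _ _) _; rewrite mulrC.
    by rewrite ler_wpM2r ?l2norm_ge0.
  rewrite dotvBr; move: (dotv _ u) (dotv _ g) => e f.
  rewrite /calm_sign; case: ifP => _.
    have := ler_normD (f - e) e; rewrite subrK distrC; lra.
  have := ler_normD (e - f) f; rewrite subrK; lra.
lra.
Qed.

End path.
Arguments grid {R d m} k.

(** Here [F] stands for the signed sum, [Sa] and [Sb] for the sums of [|v . x_t|] and of its square.
    The last two bounds give [Sa >= l k N / 4] and [Sb <= 2 N s^2 / r^2]. The choice of [th] makes
    [8 th Sb <= q l k N / 16], and the condition on [e] says [e / th <= q l k N / 16]; subtracting
    both from [q Sa] leaves [q l k N / 8]. *)
Lemma signed_sum_lower (R : realType) (F Sa Sb N q l s r k e th : R) :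
  0 < q -> q <= 1 -> 0 < l -> l <= s -> 0 < r -> r <= 1 -> 0 < k -> k <= 1 ->
  0 <= e -> 0 <= N -> th = q * l * k * r ^+ 2 / (256 * s ^+ 2) ->
  4096 * s ^+ 2 * e <= N * (q * l * k * r) ^+ 2 ->
  - (th * F) + q * (th * Sa) - 8 * (th ^+ 2 * Sb) <= e ->
  r ^+ 2 * Sb / s ^+ 2 - N <= e ->
  k * N / 2 - Sa / l <= e ->
  q * l * k * N / 8 <= F.
Proof.
move=> q0 q1 l0 ls r0 r1 k0 k1 e0 N0 thE hN h1 h2 h3.
have s0 : 0 < s by exact: lt_le_trans ls.
have s2 : 0 < s ^+ 2 by rewrite exprn_gt0.
have r2 : 0 < r ^+ 2 by rewrite exprn_gt0.
have th0 : 0 < th.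
  have s256 : 0 < 256 * s ^+ 2 by lra.
  by rewrite thE; apply: divr_gt0 => //; do !apply: mulr_gt0 => //.
have ek : e <= k * N / 4.
  have H : (q * l * k * r) ^+ 2 <= s ^+ 2 * k.
    have qr0 : 0 < q * r by exact: mulr_gt0.
    have qr1 : q * r <= 1 by apply: mulr_ile1 => //; exact: ltW.
    have qr : (q * r) ^+ 2 <= 1 by apply: exprn_ile1 => //; exact: ltW.
    have l2 : l ^+ 2 <= s ^+ 2 by rewrite lerXn2r ?nnegrE // ltW.
    have -> : (q * l * k * r) ^+ 2 = (q * r) ^+ 2 * (l ^+ 2 * (k * k)) by ring.
    apply: (@le_trans _ _ (1 * (s ^+ 2 * (k * 1)))); last by rewrite mul1r mulr1.
    apply: ler_pM => //; first exact: sqr_ge0.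
      by rewrite mulr_ge0 ?sqr_ge0 // mulr_ge0 // ltW.
    apply: ler_pM => //; first exact: sqr_ge0.
      by rewrite mulr_ge0 // ltW.
    by rewrite ler_pM2l.
  have : 4096 * s ^+ 2 * e <= N * (s ^+ 2 * k).
    by apply: le_trans hN _; rewrite ler_wpM2l.
  rewrite (_ : N * _ = s ^+ 2 * (k * N)); last by ring.
  rewrite -mulrA mulrCA ler_pM2l // => H2.
  have : 0 <= k * N by rewrite mulr_ge0 // ltW.
  lra.
have eN : e <= N.
  have : k * N <= N by rewrite ler_piMl.
  lra.
have Sal : l * (k * N / 4) <= Sa.
  have : k * N / 4 <= Sa / l by lra.
  by rewrite ler_pdivlMr // mulrC.
have Sbl : Sb <= 2 * N * s ^+ 2 / r ^+ 2.
  rewrite ler_pdivlMr // mulrC -ler_pdivrMr //; lra.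
have H1 : q * (l * (k * N / 4)) <= q * Sa by rewrite ler_pM2l.
have H2 : 8 * (th * Sb) <= q * l * k * N / 16.
  have : th * Sb <= th * (2 * N * s ^+ 2 / r ^+ 2) by rewrite ler_pM2l.
  rewrite (_ : th * (_ / _) = q * l * k * N / 128); last first.
    by rewrite thE; field; rewrite !gt_eqF.
  lra.
have H3 : e <= th * (q * l * k * N / 16).
  rewrite (_ : _ * _ = N * (q * l * k * r) ^+ 2 / (4096 * s ^+ 2)); last first.
    by rewrite thE; field; rewrite !gt_eqF.
  have s4096 : 0 < 4096 * s ^+ 2 by lra.
  rewrite (ler_pdivlMr _ _ s4096) [leLHS]mulrC; exact: hN.
rewrite -(ler_pM2l th0).
have : th * (q * (l * (k * N / 4))) <= th * (q * Sa) by rewrite ler_pM2l.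
have : th * (8 * (th * Sb)) <= th * (q * l * k * N / 16) by rewrite ler_pM2l.
move: h1 H3; rewrite expr2; lra.
Qed.

Lemma recovery_path (R : realType) (d T m : nat) (A B : 'M[R]_d)
    (x w : nat -> 'cV[R]_d) (p N q l s k b de e th : R) :
  (forall t, (t < T)%N -> x t.+1 = A *m x t + w t) ->
  opnorm A < 1 -> b = (1 + opnorm A) / 2 -> A^T = b *: B ->
  0 < q -> q <= 1 -> 0 < l -> l <= s -> 0 < k -> k <= 1 -> 0 <= e -> 2 <= N ->
  0 < p -> N = p * T%:R -> (1 < T)%N -> 0 < de -> (0 < m)%N ->
  th = q * l * k * (1 - b) ^+ 2 / (256 * s ^+ 2) ->
  4096 * s ^+ 2 * e <= N * (q * l * k * (1 - b)) ^+ 2 ->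
  d%:R / m%:R <= 4^-1 :> R ->
  d%:R / m%:R * (4 * d%:R * s * N / (de * (1 - opnorm A))) < q * l * k * N / 8 ->
  l2norm (x 0%N) + \sum_(t < T) l2norm (w t) <= 2 * d%:R * s * (1 + N) / de ->
  (forall g : {ffun 'I_d -> 'I_(2 * m).+1}, let v : 'cV[R]_d := grid g in
    4^-1 <= l2norm v -> l2norm v <= 1 ->
    [/\ \sum_(t < T) (- calm_sign (w t) * (th * `|dotv (x t) v|) +
          q * (th * `|dotv (x t) v|) - 8 * (th * `|dotv (x t) v|) ^+ 2) <= e,
        (lyap B b T v (x 0%N) + \sum_(t < T) lyap B b (T - t.+1) v (w t))
          / s ^+ 2 - N <= e &
        p * k * T.-1%:R - \sum_(t < T.-1) `|dotv (x t.+1) v / l| <= e]) ->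
  unique_minimizer (l1_objective T x) A.
Proof.
move=> dyn A1 bE AB q0 q1 l0 ls k0 k1 e0 N2 p0 NE T1 de0 m0 thE hN dm dS hS good.
have A0 := opnorm_ge0 A.
have b0 : 0 < b by rewrite bE; lra.
have b1 : b < 1 by rewrite bE; lra.
have r0 : 0 < 1 - b by rewrite subr_gt0.
have r1 : 1 - b <= 1 by rewrite lerBlDr lerDl ltW.
have s0 : 0 < s by exact: lt_le_trans ls.
apply: (signed_sum_unique_minimizer dyn).
apply: (signed_sum_grid m0 dm _ dS) => [|g g1 g2].
  have h0 : 0 < 1 - opnorm A by rewrite subr_gt0.
  rewrite invfM mulrA ler_pdivlMr // mulrC.
  apply: (le_trans (sum_l2norm (ltW A1) dyn)); apply: (le_trans hS).
  rewrite ler_pM2r ?invr_gt0 //.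
  have ds : 0 <= d%:R * s by rewrite mulr_ge0 ?ler0n // ltW.
  clear -ds N2; rewrite -!(mulrA _ (d%:R) s).
  move: (d%:R * s) ds => z z0; nra.
have [h1 h2 h3] := good g g1 g2; move: (grid g) g1 g2 h1 h2 h3 => v v1 v2 h1 h2 h3.
set a := fun t => `|dotv (x t) v|.
apply: (@signed_sum_lower _ _ (\sum_(t < T) a t) (\sum_(t < T) dotv (x t) v ^+ 2)
  N q l s (1 - b) k e th) => //.
- by clear -N2; lra.
- apply: le_trans h1; rewrite le_eqVlt; apply/orP; left; apply/eqP.
  rewrite !mulr_sumr -sumrN -big_split -sumrB; apply: eq_bigr => t _ /=.
  by rewrite -[dotv _ _ ^+ 2]real_normK ?num_real // /a; ring.
- apply: le_trans h2; rewrite lerD2r ler_pM2r ?invr_gt0 ?exprn_gt0 //.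
  by apply: (lyap_sum b0 b1 AB) => //.
(* The term of [x_0] is dropped, excitation being read only after a disturbance; [T - 1 >= T / 2]
   accounts for the half in [k * N / 2]. *)
- have aS : \sum_(t < T.-1) `|dotv (x t.+1) v / l| <= (\sum_(t < T) a t) / l.
    rewrite mulr_suml -(prednK (ltnW T1)) big_ord_recl /=.
    rewrite -[leLHS]add0r lerD //; first by rewrite divr_ge0 ?normr_ge0 ?ltW.
    apply: ler_sum => t _.
    by rewrite normrM [`|l^-1|]gtr0_norm ?invr_gt0.
  have TT : T%:R / 2 <= T.-1%:R :> R.
    rewrite ler_pdivrMr // -natrM ler_nat; case: (T) T1 => [|[|n]] // _.
    by rewrite /= muln2 doubleS !ltnS -addnn leq_addr.
  have : k * N / 2 <= p * k * T.-1%:R.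
    rewrite NE (_ : k * (p * _) / 2 = p * k * (T%:R / 2)); last by ring.
    by rewrite ler_pM2l // mulr_gt0.
  lra.
Qed.

(** * Arithmetic of the sample size *)

(** The inverse mesh is polynomial in [Y = d tau / (de q h)], so its logarithm is of the order
    already present in the sample size. The exponent 5 is dictated by [tau], which may be below 1;
    [d] and [(de q h)^-1] are at least 1, so their powers can be raised to fit. *)
Lemma grid_log_card (R : realType) (c tau de q h X : R) (d m : nat) :
  1 <= c -> 0 < tau -> 0 < de -> de <= 1 -> 0 < q -> q <= 1 -> 0 < h ->
  h <= 1 -> (0 < d)%N ->
  40 * X = c * tau ^+ 5 * d%:R ^+ 2 / (de * h * q) -> 4 <= X ->
  m%:R <= X + 1 ->
  ln (8 * ((2 * m).+1 ^ d)%:R / de) <=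
    d%:R * ((ln c + 5) * Num.max 1 (ln (d%:R * tau / (de * q * h)))).
Proof.
move=> c1 tau0 de0 de1 q0 q1 h0 h1 d0 XE X4 mX.
have d1 : 1 <= d%:R :> R by rewrite ler1n.
have dp : 0 < d%:R :> R by rewrite ltr0n.
have cp : 0 < c by lra.
set Y := d%:R * tau / (de * q * h).
pose D := de * q * h.
have D0 : 0 < D by rewrite /D !mulr_gt0.
have Y0 : 0 < Y by apply: divr_gt0 => //; exact: mulr_gt0.
have X0 : 0 < 40 * X / de by apply: divr_gt0 => //; lra.
(* [2 m + 1 <= 2 X + 3 <= 5 X], and [8 / de >= 1] is absorbed into the power [d]; hence 40 as 8
   times 5. *)
have H1 : 8 * ((2 * m).+1 ^ d)%:R / de <= (40 * X / de) ^+ d.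
  have -> : 40 * X / de = 8 / de * (5 * X) by field; rewrite gt_eqF.
  rewrite exprMn mulrAC natrX; apply: ler_pM.
  - by rewrite divr_ge0 //; lra.
  - by rewrite exprn_ge0 // ler0n.
  - have : 1 <= 8 / de by rewrite ler_pdivlMr //; lra.
    by move=> z1; rewrite -[leLHS]expr1; apply: ler_weXn2l.
  - apply: lerXn2r; rewrite ?nnegrE ?ler0n //; first lra.
    by rewrite -natr1 natrM; lra.
have H2 : 40 * X / de <= c * Y ^+ 5.
  rewrite (_ : 40 * X / de = c * tau ^+ 5 * (d%:R ^+ 2 / (de * D))); last first.
    by rewrite XE /D; field; rewrite !gt_eqF.
  rewrite (_ : c * Y ^+ 5 = c * tau ^+ 5 * (d%:R ^+ 5 / D ^+ 5)); last first.
    by rewrite /Y -/D; field; rewrite gt_eqF.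
  apply: ler_wpM2l.
    by apply: mulr_ge0; [lra|apply: exprn_ge0; exact: ltW].
  have D1 : D <= de.
    rewrite /D -mulrA ler_piMr //; first exact: ltW.
    by apply: mulr_ile1 => //; exact: ltW.
  have D01 : D <= 1 by lra.
  apply: ler_pM.
  - exact: sqr_ge0.
  - by rewrite invr_ge0 mulr_ge0 // ltW.
  - exact: ler_weXn2l.
  rewrite lef_pV2 ?posrE ?exprn_gt0 ?mulr_gt0 // exprS mulrC.
  rewrite ler_pM2r //; apply: le_trans D1.
  rewrite exprS; apply: ler_piMr; first exact: ltW.
  by apply: exprn_ile1 => //; exact: ltW.
have P1 : 0 < 8 * ((2 * m).+1 ^ d)%:R / de.
  by apply: divr_gt0 => //; apply: mulr_gt0; rewrite ?ltr0n ?expn_gt0.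
have P2 : 0 < (40 * X / de) ^+ d by exact: exprn_gt0.
apply: (@le_trans _ _ (ln ((40 * X / de) ^+ d))); first by rewrite ler_ln ?posrE.
rewrite lnXn // -[leLHS]mulr_natl ler_pM2l //.
have Y5 : 0 < Y ^+ 5 by exact: exprn_gt0.
have cY : 0 < c * Y ^+ 5 by exact: mulr_gt0.
apply: (@le_trans _ _ (ln (c * Y ^+ 5))); first by rewrite ler_ln ?posrE.
rewrite lnM ?posrE // lnXn // -[ln Y *+ 5]mulr_natl.
have := ln_ge0 c1; set mL := Num.max _ _ => lnc.
have LY : ln Y <= mL by rewrite /mL le_max lexx orbT.
have L1 : 1 <= mL by rewrite /mL le_max lexx.
have : ln c <= ln c * mL by apply: ler_peMr.
lra.
Qed.

(* The arithmetic of the sample size: [m] is the inverse mesh of the grid and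
   [e] the logarithm of the (inverse) failure probability allowed at each of
   its [(2 m + 1) ^ d] points. *)
Lemma sample_size (R : realType) (c1 c2 : R) : 1 <= c1 -> 1 <= c2 ->
  exists C : R, 0 < C /\
  forall (d T : nat) (sg lam p de rho : R), (0 < d)%N -> 0 < sg -> 0 < lam ->
    lam / 4 <= 2 * sg -> 0 < p -> p < 2^-1 -> 0 < de -> de <= 1 ->
    0 <= rho -> rho < 1 ->
    C * (d%:R * Num.max 1 ((sg / lam) ^+ 10)
         / (p * (1 - 2 * p) ^+ 2 * (1 - rho) ^+ 2))
      * Num.max 1 (ln (d%:R * (sg / lam)
                       / (de * (1 - 2 * p) * (1 - rho))))
      <= T%:R ->
  exists m : nat, (0 < m)%N /\ let s := 2 * sg in let l := lam / 4 in
    let k := l ^+ 4 / (c1 * s ^+ 4) in let N := p * T%:R in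
    let q := 1 - 2 * p in let r := (1 - rho) / 2 in
    let e := ln (8 * ((2 * m).+1 ^ d)%:R / de) in
    [/\ 2 <= N, 0 <= e,
      c2 * s ^+ 2 * e <= N * (q * l * k * r) ^+ 2,
      d%:R / m%:R <= 4^-1 :> R &
      d%:R / m%:R * (4 * d%:R * s * N / (de * (1 - rho))) < q * l * k * N / 8].
Proof.
move=> c1_1 c2_1.
(* [b] is the ratio of [s / l = 2 sg / (lam / 4)] to [tau = sg / lam]. *)
have [b [b1 bE]] : exists b : R, 1 <= b /\ b = 8 by exists 8; split=> //; lra.
have c1p : 0 < c1 by lra.
have c2p : 0 < c2 by lra.
have b5 : 1 <= b ^+ 5 by exact: exprn_ege1.
have b10 : 1 <= b ^+ 10 by exact: exprn_ege1.
have c11 : 1 <= c1 ^+ 2 by exact: exprn_ege1.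
have [c' [c'1 c'E]] : exists c', 1 <= c' /\ c' = 40 * (32 * c1 * b ^+ 5).
  exists (40 * (32 * c1 * b ^+ 5)); split=> //; clear -c1_1 b5.
  by move: (b ^+ 5) b5 => z z1; nra.
(* Solving the third requirement for [N], with [k^-1 = c1 g^4] and [s = g l], produces
   [c2 c1^2 g^10] where [g = b tau]; the 4 comes from [r = h / 2]. *)
have [a [a2 aE]] : exists a, 2 <= a /\ a = 4 * c2 * c1 ^+ 2 * b ^+ 10.
  exists (4 * c2 * c1 ^+ 2 * b ^+ 10); split=> //; clear -c2_1 c11 b10.
  move: (b ^+ 10) (c1 ^+ 2) b10 c11 => z y z1 y1.
  have H : 1 <= c2 * y by nra.
  have -> : 4 * c2 * y * z = 4 * (c2 * y * z) by ring.
  have : 1 <= c2 * y * z by exact: mulr_ege1.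
  lra.
have lnc' : 0 <= ln c' by exact: ln_ge0.
exists (a * (ln c' + 5)); split; first by apply: mulr_gt0; lra.
move=> d T sg lam p de rho d0 sg0 lam0 ls p0 p1 de0 de1 rho0 rho1 hT.
have [h [hE h0 h1]] : exists h, [/\ h = 1 - rho, 0 < h & h <= 1].
  by exists (1 - rho); split=> //; lra.
have [q [qE q0 q1]] : exists q, [/\ q = 1 - 2 * p, 0 < q & q <= 1].
  by exists (1 - 2 * p); split=> //; lra.
have [tau [tauE tau0]] : exists tau, tau = sg / lam /\ 0 < tau.
  by exists (sg / lam); split=> //; exact: divr_gt0.
have [l [lE l0]] : exists l, l = lam / 4 /\ 0 < l by exists (lam / 4); split=> //; lra.
have [g [gE g0]] : exists g, g = b * tau /\ 0 < g.
  by exists (b * tau); split=> //; apply: mulr_gt0 => //; lra.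
have sE : 2 * sg = g * l.
  by rewrite gE bE tauE lE; field; rewrite gt_eqF.
have g1 : 1 <= g.
  by move: ls; rewrite -lE sE -[X in X <= _]mul1r ler_pM2r.
rewrite -hE -qE -tauE in hT.
have [N NE] : exists N, N = p * T%:R by exists (p * T%:R).
set mL := Num.max 1 (ln _) in hT.
have mL1 : 1 <= mL by rewrite le_max lexx.
set mt := Num.max 1 (tau ^+ 10) in hT.
have mt1 : 1 <= mt by rewrite le_max lexx.
have mt2 : tau ^+ 10 <= mt by rewrite le_max lexx orbT.
have d1 : 1 <= d%:R :> R by rewrite ler1n.
have hN : a * (ln c' + 5) * (d%:R * mt * mL) <= N * q ^+ 2 * h ^+ 2.
  have qh : 0 < q ^+ 2 * h ^+ 2 by apply: mulr_gt0; exact: exprn_gt0.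
  have := ler_wpM2l (ltW (mulr_gt0 p0 qh)) hT.
  rewrite [X in _ <= X -> _](_ : _ = N * q ^+ 2 * h ^+ 2); last by rewrite NE; ring.
  apply: le_trans; rewrite le_eqVlt; apply/orP; left; apply/eqP.
  by field; rewrite !gt_eqF.
have N2 : 2 <= N.
  have N0 : 0 <= N by rewrite NE mulr_ge0 ?ler0n // ltW.
  have : N * q ^+ 2 * h ^+ 2 <= N.
    rewrite -mulrA ler_piMr // mulr_ile1 ?sqr_ge0 //.
      by apply: exprn_ile1 => //; exact: ltW.
    by apply: exprn_ile1 => //; exact: ltW.
  apply: le_trans; apply: le_trans hN.
  have H : 1 <= d%:R * mt * mL.
    by apply: mulr_ege1 => //; exact: mulr_ege1.
  have : 2 <= a * (ln c' + 5).
    by clear -a2 lnc'; move: (ln c') lnc' => z z0; nra.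
  by clear -H; move: (_ * mL) (a * _) H => z y z1 y1; nra.
have k_gt : 0 < c1 * g ^+ 4 by apply: mulr_gt0 => //; exact: exprn_gt0.
have [k [kE k0]] : exists k, k = (c1 * g ^+ 4)^-1 /\ 0 < k.
  by exists (c1 * g ^+ 4)^-1; rewrite invr_gt0.
have kE' : l ^+ 4 / (c1 * (g * l) ^+ 4) = k.
  by rewrite kE; field; rewrite !gt_eqF.
have den0 : 0 < de * h * q by rewrite !mulr_gt0.
have den1 : de * h * q <= 1.
  by apply: mulr_ile1 => //; rewrite ?mulr_ge0 ?mulr_ile1 // ltW.
have g5 : 1 <= g ^+ 5 by exact: exprn_ege1.
(* [X] is the value of [m] at which the last requirement would be an equality, as [XB] records; the
   next integer makes it strict. *)
have [X XE] : exists X, X = 32 * c1 * g ^+ 5 * d%:R ^+ 2 / (de * h * q) by eexists.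
have X4 : 4 * d%:R <= X.
  rewrite XE ler_pdivlMr //.
  apply: (@le_trans _ _ (4 * d%:R * 1)).
    by rewrite ler_pM2l // mulr_gt0 // ltr0n.
  clear -d1 g5 c1_1; rewrite mulr1.
  move: (g ^+ 5) (d%:R) g5 d1 => z y z1 y1.
  have : 1 <= c1 * z by nra.
  rewrite -(mulrA 32); move: (c1 * z) => w w1.
  have H1 : y <= y ^+ 2 by nra.
  have H2 : y ^+ 2 <= w * y ^+ 2 by apply: ler_peMl; rewrite ?sqr_ge0.
  by rewrite -(mulrA 32 w); lra.
have X1 : 4 <= X by lra.
have /andP[mX1 mX2] : (Num.truncn X)%:R <= X < (Num.truncn X).+1%:R.
  by apply: truncn_itv; lra.
have [m [mE m_gt0]] : exists m, m = (Num.truncn X).+1 /\ (0 < m)%N by eexists.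
rewrite -mE in mX2.
have mX : m%:R <= X + 1 by rewrite mE -natr1; lra.
have m0 : 0 < m%:R :> R by rewrite ltr0n.
exists m; split=> //=.
rewrite sE -hE -qE -lE kE' -NE.
set e := ln _.
have e0 : 0 <= e.
  apply: ln_ge0; rewrite ler_pdivlMr // mul1r; apply: (le_trans de1).
  have : 1 <= ((2 * m).+1 ^ d)%:R :> R by rewrite ler1n expn_gt0.
  by clear; lra.
have ee : e <= d%:R * ((ln c' + 5) * mL).
  apply: (@grid_log_card _ c' tau de q h X d m) => //.
  by rewrite XE c'E gE; ring.
have g10 : 4 * (c2 * c1 ^+ 2 * g ^+ 10 * e) = a * (tau ^+ 10 * e).
  by rewrite aE gE; ring.
have XB : d%:R / m%:R * (4 * d%:R * (g * l) * N / (de * h)) =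
    q * l * k * N / 8 * (X / m%:R).
  by rewrite XE kE; field; rewrite !gt_eqF.
clear hT XE mE kE' gE hE qE lE ls.
split=> //.
- have Nqr : c2 * c1 ^+ 2 * g ^+ 10 * e <= N * (q * (h / 2)) ^+ 2.
    rewrite (_ : N * (q * _) ^+ 2 = N * q ^+ 2 * h ^+ 2 / 4); last by field.
    rewrite ler_pdivlMr // [leLHS]mulrC g10; apply: le_trans hN.
    have a0 : 0 <= a by clear -a2; lra.
    have t10 : 0 <= tau ^+ 10 by apply: exprn_ge0; exact: ltW.
    rewrite [leRHS](_ : _ = a * (mt * (d%:R * ((ln c' + 5) * mL)))); last by ring.
    by apply: (ler_wpM2l a0); exact: ler_pM t10 e0 mt2 ee.
  rewrite (_ : N * (q * l * k * (h / 2)) ^+ 2 = N * (q * (h / 2)) ^+ 2 * (l * k) ^+ 2); last ring.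
  apply: le_trans (ler_wpM2r (sqr_ge0 (l * k)) Nqr).
  rewrite le_eqVlt; apply/orP; left; apply/eqP.
  by rewrite kE; field; rewrite !gt_eqF.
- rewrite ler_pdivrMr // ler_pdivlMl //; lra.
- rewrite XB.
  have N0 : 0 < N by clear -N2; lra.
  have := mulr_gt0 (mulr_gt0 (mulr_gt0 q0 l0) k0) N0.
  move: (q * l * k * N) => z z0.
  have B0 : 0 < z / 8 by clear -z0; lra.
  rewrite -[ltRHS]mulr1 (ltr_pM2l B0) (ltr_pdivrMr _ _ m0) mul1r.
  exact: mX2.
Qed.

(** * Measurability and moments of random vectors *)

Section borel_vectors.
Context (R : realType) (d : nat).

Lemma measurable_coord (i : 'I_d) :
  measurable_fun setT (fun y : borelV R d => (y : 'cV[R]_d) i 0).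
Proof.
apply: (measurability _ (RGenOpens.measurableE R)) => _ [_ [a [b ->] <-]].
rewrite setTI; apply: sub_sigma_algebra.
move: (@coord_continuous R d 1 i 0) => /continuousP; apply.
exact: interval_open.
Qed.

Lemma measurable_dotv dT (T : measurableType dT) (W : T -> 'cV[R]_d) v :
  measurable_fun setT (W : T -> borelV R d) ->
  measurable_fun setT (fun y => dotv (W y) v).
Proof.
move=> mW; apply: measurable_sum => i; apply: measurable_funM => //.
exact: (measurableT_comp (measurable_coord i) mW).
Qed.

Lemma measurable_neq0 dT (T : measurableType dT) (W : T -> 'cV[R]_d) :
  measurable_fun setT (W : T -> borelV R d) ->
  measurable [set y | W y != 0].
Proof.
move=> mW.
have mq : measurable_fun setT (fun y => dotv (W y) (W y)).
  apply: measurable_sum => i; apply: measurable_funM;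
    exact: (measurableT_comp (measurable_coord i) mW).
rewrite (_ : [set _ | _] = ~` ((fun y => dotv (W y) (W y)) @^-1` [set 0])).
  by apply: measurableC; rewrite -[X in measurable X]setTI; exact: mq.
apply/seteqP; split => y /=.
  by move=> /negP Wy /dotv_eq0 /eqP.
by move=> Wy; apply/eqP => Wy0; apply: Wy; rewrite Wy0 dotv0l.
Qed.

(** The infimum lies below [s], hence so does some admissible constant, and the integral does not
    increase with that constant. The strict [c < s] avoids discussing whether the infimum is
    attained, and is the reason for taking [s = 2 sigma_w]. *)
Lemma psi2_vnorm_expR dT (T : measurableType dT)
    (mu : {measure set T -> \bar R}) (W : T -> 'cV[R]_d) (c s : R) v :
  measurable_fun setT (W : T -> borelV R d) ->
  c < s -> (psi2_vnorm mu W <= c%:E)%E -> l2norm v <= 1 ->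
  (\int[mu]_y (expR (dotv (W y) v ^+ 2 / s ^+ 2))%:E <= 2%:E)%E.
Proof.
move=> mW cs Wc v1.
have : (psi2_norm mu (fun y => dotv (W y) v) < s%:E)%E.
  rewrite (@le_lt_trans _ _ c%:E) ?lte_fin //; apply: le_trans Wc.
  by apply: ereal_sup_ubound; exists v.
move=> /ereal_inf_lt[_ [c' /= [c'0 Wc'] <-]]; rewrite lte_fin => c's.
apply: le_trans Wc'.
have mD := measurable_dotv v mW.
have me r : measurable_fun setT (fun y => expR (dotv (W y) v ^+ 2 / r ^+ 2)).
  apply: measurableT_comp => //; apply: measurable_funM => //.
  exact: measurable_funX.
apply: le_mean => // y.
rewrite ler_expR ler_wpM2l ?sqr_ge0 // lef_pV2 ?posrE ?exprn_gt0 //.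
  by rewrite lerXn2r ?nnegrE // ltW // (lt_trans c'0).
exact: lt_trans c's.
Qed.

Lemma expR_convex (t a b : R) : 0 <= t -> t <= 1 ->
  expR ((1 - t) * a + t * b) <= (1 - t) * expR a + t * expR b.
Proof.
move=> t0 t1.
set c := (1 - t) * a + t * b.
have key x : expR c * (1 + (x - c)) <= expR x.
  rewrite -[in leRHS](subrKC c x) [leRHS]expRD ler_pM2l ?expR_gt0 //.
  exact: expR_ge1Dx.
have Ha : (1 - t) * (expR c * (1 + (a - c))) <= (1 - t) * expR a.
  by rewrite ler_wpM2l ?subr_ge0.
have Hb := ler_wpM2l t0 (key b).
apply: le_trans (lerD Ha Hb); rewrite le_eqVlt; apply/orP; left; apply/eqP.
by rewrite /c; ring.
Qed.

Lemma measurable_lyap dT (T : measurableType dT) (W : T -> 'cV[R]_d)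
    (B : 'M[R]_d) (b : R) n v :
  measurable_fun setT (W : T -> borelV R d) ->
  measurable_fun setT (fun y => lyap B b n v (W y)).
Proof.
move=> mW; elim: n v => [|n IH] v //=.
apply: measurable_funD; apply: measurable_funM => //.
by apply: measurable_funX; exact: measurable_dotv.
Qed.

(** Convexity of the exponential along the recursion, the contraction [B] keeping the direction in
    the unit ball. The bound 2 is inherited without loss in [n] or [d]. *)
Lemma lyap_expR dT (T : measurableType dT) (mu : probability T R)
    (W : T -> 'cV[R]_d) (B : 'M[R]_d) (b s : R) n v :
  0 < b -> b < 1 -> measurable_fun setT (W : T -> borelV R d) ->
  (forall v, l2norm (B *m v) <= l2norm v) ->
  (forall v, l2norm v <= 1 ->
    (\int[mu]_y (expR (dotv (W y) v ^+ 2 / s ^+ 2))%:E <= 2%:E)%E) ->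
  l2norm v <= 1 ->
  (\int[mu]_y (expR (lyap B b n v (W y) / s ^+ 2))%:E <= 2%:E)%E.
Proof.
move=> b0 b1 mW BC W2.
elim: n v => [|n IH] v v1.
  under eq_integral do rewrite /= mul0r expR0.
  by rewrite mean_cst lee_fin ler1n.
have mD := measurable_dotv v mW.
have ml : measurable_fun setT (fun y => expR (lyap B b n (B *m v) (W y) / s ^+ 2)).
  apply: measurableT_comp => //; apply: measurable_funM => //.
  exact: measurable_lyap.
have me : measurable_fun setT (fun y => expR (dotv (W y) v ^+ 2 / s ^+ 2)).
  apply: measurableT_comp => //; apply: measurable_funM => //.
  exact: measurable_funX.
have b1' : 0 <= 1 - b by rewrite subr_ge0 ltW.
have m1 : measurable_fun setT (fun y =>
    (1 - b) * expR (dotv (W y) v ^+ 2 / s ^+ 2)) by exact: measurable_funM.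
have m2 : measurable_fun setT (fun y =>
    b * expR (lyap B b n (B *m v) (W y) / s ^+ 2)) by exact: measurable_funM.
apply: (@le_trans _ _ (\int[mu]_y ((1 - b) * expR (dotv (W y) v ^+ 2 / s ^+ 2)
    + b * expR (lyap B b n (B *m v) (W y) / s ^+ 2))%:E)%E).
  apply: le_mean => [|||y].
  - apply: measurableT_comp => //; apply: measurable_funM => //.
    exact: measurable_lyap.
  - exact: measurable_funD.
  - by move=> y; exact: expR_ge0.
  - rewrite (_ : lyap _ _ _ _ _ / _ = (1 - b) * (dotv (W y) v ^+ 2 / s ^+ 2) +
      b * (lyap B b n (B *m v) (W y) / s ^+ 2)); last by rewrite /=; ring.
    by apply: expR_convex; rewrite ltW.
rewrite meanD //; last 2 first.
- by move=> y; rewrite mulr_ge0 ?expR_ge0.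
- by move=> y; rewrite mulr_ge0 ?expR_ge0 ?ltW.
rewrite !meanZ ?(ltW b0) //.
rewrite (_ : 2%:E = ((1 - b)%:E * 2%:E + b%:E * 2%:E)%E); last first.
  by rewrite -!EFinM -EFinD; congr _%:E; ring.
apply: leeD; apply: lee_wpmul2l; rewrite ?lee_fin ?(ltW b0) //.
  exact: W2.
by apply: IH; exact: le_trans (BC v) v1.
Qed.

(** The entries of [shifted_second_moment] are real-valued integrals, meaningful only when finite.
    Sub-Gaussian tails make all products of coordinates integrable, after which the quadratic form
    at [v] is a finite sum exchanged with the integral. *)
Lemma loewner_second_moment (mu : probability (borelV R d) R)
    (l s : R) (z v : 'cV[R]_d) : 0 < s ->
  (forall v, l2norm v <= 1 ->
    (\int[mu]_y (expR (dotv (y : 'cV[R]_d) v ^+ 2 / s ^+ 2))%:E <= 2%:E)%E) ->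
  loewner_le (l ^+ 2)%:M (shifted_second_moment mu id z) ->
  (((l * l2norm v) ^+ 2)%:E <=
    \int[mu]_y ((dotv z v + dotv (y : 'cV[R]_d) v) ^+ 2)%:E)%E.
Proof.
move=> s0 W2 [_ /(_ v)].
have mid : measurable_fun setT (id : borelV R d -> borelV R d) by [].
have mc i : measurable_fun setT (fun y : borelV R d => (z + y : 'cV[R]_d) i 0).
  under eq_fun do rewrite mxE.
  apply: measurable_funD => //; exact: measurable_coord.
have isq i : mu.-integrable setT
    (EFin \o (fun y : borelV R d => (y : 'cV[R]_d) i 0 ^+ 2)).
  apply/integrableP; split.
    by apply/measurable_EFinP; apply: measurable_funX; exact: measurable_coord.
  under eq_integral do rewrite /= ger0_norm ?sqr_ge0 // -(dotv_delta _ i).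
  apply: le_lt_trans (subgaussian_mean_sqr s0 (measurable_dotv _ mid) _) _.
    apply: W2.
    rewrite -(@ler_pXn2r _ 2) ?nnegrE ?l2norm_ge0 // l2norm_sqr dotv_delta mxE.
    by rewrite !eqxx expr1n.
  exact: ltry.
have iY i j : mu.-integrable setT (EFin \o
    (fun y : borelV R d => (z + y : 'cV[R]_d) i 0 * (z + y : 'cV[R]_d) j 0)).
  pose g i (y : borelV R d) := 2 * z i 0 ^+ 2 + 2 * (y : 'cV[R]_d) i 0 ^+ 2.
  have ig k : mu.-integrable setT (EFin \o g k).
    rewrite (_ : _ \o _ = (cst (2 * z k 0 ^+ 2)%:E) \+ (fun y : borelV R d =>
      2%:E * ((y : 'cV[R]_d) k 0 ^+ 2)%:E))%E //.
    apply: integrableD => //; last exact: integrableZl (isq k).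
    exact: finite_measure_integrable_cst.
  apply: le_integrable (integrableD _ (ig i) (ig j)) => //.
    by apply/measurable_EFinP; exact: measurable_funM.
  move=> y _; rewrite /= lee_fin [leRHS]ger0_norm; last first.
    by rewrite /g; do !apply: addr_ge0; apply: mulr_ge0; rewrite ?sqr_ge0.
  rewrite !mxE /g.
  move: (z i 0) (z j 0) ((y : 'cV[R]_d) i 0) ((y : 'cV[R]_d) j 0) => p q e f.
  rewrite ler_norml; apply/andP; split.
    have := sqr_ge0 (p + e + (q + f)); have := sqr_ge0 (p - e).
    have := sqr_ge0 (q - f); nra.
  have := sqr_ge0 (p + e - (q + f)); have := sqr_ge0 (p - e).
  have := sqr_ge0 (q - f); nra.
set M := shifted_second_moment mu id z.
have ME i j : (M i j)%:E = (\int[mu]_y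
    ((z + y : 'cV[R]_d) i 0 * (z + y : 'cV[R]_d) j 0)%:E)%E.
  rewrite -[RHS]fineK; last exact: (integrable_fin_num measurableT (iY i j)).
  rewrite /M mxE /Rintegral; congr (fine _)%:E.
  by apply: eq_integral => y _; rewrite mxE big_ord1 [(_^T) _ _]mxE.
have -> : (\int[mu]_y ((dotv z v + dotv (y : 'cV[R]_d) v) ^+ 2)%:E)%E =
    ((v^T *m M *m v) 0 0)%:E.
  pose Y i j (y : borelV R d) :=
    ((z + y : 'cV[R]_d) i 0 * (z + y : 'cV[R]_d) j 0)%:E.
  transitivity (\int[mu]_y \sum_(j < d) \sum_(i < d)
      (v i 0 * v j 0)%:E * Y i j y)%E.
    apply: eq_integral => y _; rewrite -dotvDl expr2 /dotv mulr_suml -sumEFin.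
    rewrite exchange_big; apply: eq_bigr => i _ /=.
    rewrite mulr_sumr -sumEFin; apply: eq_bigr => j _.
    by rewrite /Y -EFinM; congr _%:E; ring.
  have iYv i j : mu.-integrable setT (fun y => (v i 0 * v j 0)%:E * Y i j y)%E.
    by apply: integrableZl => //; exact: iY.
  rewrite integral_sum //; last by move=> j; exact: integrable_sum.
  rewrite mxE -sumEFin; apply: eq_bigr => j _.
  rewrite integral_sum // mxE mulr_suml -sumEFin; apply: eq_bigr => i _.
  rewrite integralZl //; last exact: iY.
  by rewrite /Y -ME -EFinM [v^T _ _]mxE; congr _%:E; ring.
rewrite mulmxBr mulmxBl mxE [X in _ + X]mxE subr_ge0 lee_fin; apply: le_trans.
rewrite mul_mx_scalar -scalemxAl mxE exprMn l2norm_sqr.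
rewrite ler_wpM2l ?sqr_ge0 // mxE.
by apply: ler_sum => i _; rewrite mxE.
Qed.

End borel_vectors.

(** * Change of sigma-algebra and scalar exponential inequalities *)

Lemma measurable_g_sigmaS d d' (T : measurableType d) (Y : measurableType d')
    (G G' : set (set T)) (f : T -> Y) : G `<=` G' ->
  measurable_fun setT (f : g_sigma_algebraType G -> Y) ->
  measurable_fun setT (f : g_sigma_algebraType G' -> Y).
Proof.
move=> GG' mf _ B mB; rewrite setTI.
have := mf measurableT B mB; rewrite setTI.
exact: sub_sigma_algebra2.
Qed.

Lemma measurable_g_sigmaT d d' (T : measurableType d) (Y : measurableType d')
    (G : set (set T)) (f : T -> Y) : G `<=` measurable ->
  measurable_fun setT (f : g_sigma_algebraType G -> Y) -> measurable_fun setT f.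
Proof.
by move=> GM mf; exact: (measurableT_comp mf (measurable_id_sub GM)).
Qed.

(** For [x > 2^-1] one has [x <= 2 x^2]; otherwise [expR x <= (1 - x)^-1 <= 1 + x + 2 x^2]. The term
    [x] is kept outside the exponential so as to vanish in the mean of a centred variable. *)
Lemma expR_le_addr_sqr (R : realType) (x : R) : expR x <= x + expR (2 * x ^+ 2).
Proof.
have E := expR_ge1Dx (2 * x ^+ 2).
have [x1|x1] := leP x 2^-1; last first.
  have : expR x <= expR (2 * x ^+ 2) by rewrite ler_expR; nra.
  lra.
have : expR x * (1 - x) <= 1.
  rewrite -[x in expR x]opprK expRN mulrC ler_pdivrMr ?expR_gt0 // mul1r.
  by have := expR_ge1Dx (- x); lra.
have := expR_gt0 x; move: (expR x) => e e0 ex.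
suff : e <= 1 + x + 2 * x ^+ 2 by lra.
have x0 : 0 < 1 - x by lra.
rewrite -(ler_pM2r x0); apply: le_trans ex _; nra.
Qed.

(* A crude form of Hoeffding's lemma, for the variable equal to [- 2 p] with
   probability [1 - p] and to [2 - 2 p] with probability [p]. *)
Lemma two_point_mgf (R : realType) (p u : R) : 0 < p -> p < 2^-1 ->
  (1 - p) * expR (- (2 * p) * u) + p * expR ((2 - 2 * p) * u) <=
  expR (8 * u ^+ 2).
Proof.
move=> p0 p1.
have u2 := sqr_ge0 u.
have H1 : expR (- (2 * p) * u) <= - (2 * p) * u + expR (8 * u ^+ 2).
  apply: le_trans (expR_le_addr_sqr _) _; rewrite lerD2l ler_expR exprMn.
  have : (- (2 * p)) ^+ 2 <= 4 by nra.
  by nra.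
have H2 : expR ((2 - 2 * p) * u) <= (2 - 2 * p) * u + expR (8 * u ^+ 2).
  apply: le_trans (expR_le_addr_sqr _) _; rewrite lerD2l ler_expR exprMn.
  have : (2 - 2 * p) ^+ 2 <= 4 by nra.
  by nra.
(* The variable is centred, so the linear terms cancel; 8 is [2 * 2^2], both values having modulus
   at most 2. *)
have p2 : 0 <= 1 - p by lra.
have := ler_wpM2l p2 H1; have := ler_wpM2l (ltW p0) H2; lra.
Qed.

Lemma markov_lt1 d (T : measurableType d) (R : realType) (P : probability T R)
    (H : T -> R) (c : R) : measurable_fun setT H -> (forall o, 0 <= H o) ->
  (\int[P]_o (H o)%:E <= c%:E)%E ->
  measurable [set o | H o < 1] /\ ((1 - c)%:E <= P [set o | (H o < 1)%R])%E.
Proof.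
move=> mH H0 Hc.
have mE : measurable [set o | H o < 1].
  rewrite (_ : [set _ | _] = H @^-1` `]-oo, 1[%classic); last first.
    by apply/seteqP; split=> o /=; rewrite in_itv.
  by rewrite -[X in measurable X]setTI; exact: mH.
split=> //; have mEC := measurableC mE.
have PC : (P (~` [set o | (H o < 1)%R]) <= c%:E)%E.
  apply: le_trans Hc; rewrite -[leLHS]mul1e -integral_cst //.
  apply: (@le_trans _ _ (\int[P]_(o in ~` [set o | (H o < 1)%R]) (H o)%:E)%E).
    apply: ge0_le_integral => //.
    - by apply: (measurable_funS measurableT) => //; exact/measurable_EFinP.
    - by move=> o /= /negP; rewrite -leNgt lee_fin.
  apply: ge0_subset_integral => //; first exact/measurable_EFinP.
  by move=> o _; rewrite lee_fin.
rewrite -[X in (_ <= P X)%E]setCK probability_setC // EFinB.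
exact: leeB.
Qed.

(** * The filtration and one-step bounds *)

Section system.
Context (R : realType) (dO : measure_display) (Omega : measurableType dO)
  (P : probability Omega R) (d T : nat) (x0 : Omega -> 'cV[R]_d)
  (w : nat -> Omega -> 'cV[R]_d)
  (K : nat -> Omega -> probability (borelV R d) R) (p : R).
Hypothesis mx0 : measurable_fun setT (x0 : Omega -> borelV R d).
Hypothesis mw : forall t, (t < T)%N ->
  measurable_fun setT (w t : Omega -> borelV R d).
Hypothesis Kw : forall t, (t < T)%N ->
  is_cond_law P (past_status x0 w t) (w t) (K t).
Hypotheses (p0 : 0 < p) (p1 : p < 2^-1).
Hypothesis attack_prob : forall t, (t < T)%N ->
  is_cond_prob P (past x0 w t) (~` attack w t) (cst (1 - p)%:E).

Implicit Types (s t n : nat) (Z f : Omega -> R) (c : R) (v : 'cV[R]_d).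

Definition adapted t (f : Omega -> R) :=
  measurable_fun setT (f : g_sigma_algebraType (past x0 w t) -> R).

Local Notation EE f := (\int[P]_o (f o)%:E)%E.

Lemma measurable_attack t : (t < T)%N -> measurable (attack w t).
Proof. by move=> tT; apply: measurable_neq0; exact: mw. Qed.

Lemma past_sub t : (t <= T)%N -> past x0 w t `<=` measurable.
Proof.
move=> tT _ [[B mB <-]|[s /= st [B mB <-]]].
  exact: mx0.
by apply: mw => //; exact: leq_trans tT.
Qed.

Lemma past_status_sub t : (t < T)%N -> past_status x0 w t `<=` measurable.
Proof.
move=> tT A [|->]; first exact: (past_sub (ltnW tT)).
exact: measurable_attack.
Qed.

Lemma pastS s t : (s <= t)%N -> past x0 w s `<=` past x0 w t.
Proof.
move=> st A [?|[r /= rs Br]]; first by left.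
by right; exists r => //=; exact: leq_trans st.
Qed.

Lemma adaptedS s t f : (s <= t)%N -> adapted s f -> adapted t f.
Proof. by move=> st; apply: measurable_g_sigmaS; exact: pastS. Qed.

Lemma adapted_measurable t f : (t <= T)%N -> adapted t f -> measurable_fun setT f.
Proof. by move=> tT; apply: measurable_g_sigmaT; exact: past_sub. Qed.

Lemma adapted_status t f : adapted t f ->
  measurable_fun setT (f : g_sigma_algebraType (past_status x0 w t) -> R).
Proof. by apply: measurable_g_sigmaS => A ?; left. Qed.

Lemma past_x0 t :
  measurable_fun setT (x0 : g_sigma_algebraType (past x0 w t) -> borelV R d).
Proof.
by move=> _ B mB; apply: sub_sigma_algebra; left; exists B.
Qed.

Lemma past_w s t : (s < t)%N ->
  measurable_fun setT (w s : g_sigma_algebraType (past x0 w t) -> borelV R d).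
Proof.
by move=> st _ B mB; apply: sub_sigma_algebra; right; exists s => //; exists B.
Qed.

Lemma adapted_dotv_w s t v : (s < t)%N -> adapted t (fun o => dotv (w s o) v).
Proof. by move=> st; apply: measurable_dotv; exact: past_w. Qed.

Lemma past_attackE t E : (t < T)%N -> <<s past x0 w t >> E ->
  (P (E `&` attack w t) = p%:E * P E)%E.
Proof.
move=> tT pE; have mE := g_sigma_sub (past_sub (ltnW tT)) pE.
have mA := measurable_attack tT.
have := (attack_prob tT).2 E pE; rewrite integral_cst // => PC.
have -> : (P (E `&` attack w t) = P E - P (E `&` ~` attack w t))%E.
  rewrite -measureD //; last 2 first.
  - exact: measurableC.
  - by rewrite (le_lt_trans (probability_le1 _ _)) ?ltry.
  by rewrite setDE setCK.
have PEfin : P E \is a fin_num by exact: fin_num_measure.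
rewrite -PC; suff H (e : \bar R) : e \is a fin_num ->
  (e - (1 - p)%:E * e = p%:E * e)%E by exact: H.
by case: e => // r _; rewrite -!EFinM -EFinB; congr _%:E; ring.
Qed.

Lemma past_calmE t E : (t < T)%N -> <<s past x0 w t >> E ->
  (P (E `&` ~` attack w t) = (1 - p)%:E * P E)%E.
Proof.
move=> tT pE; have mE := g_sigma_sub (past_sub (ltnW tT)) pE.
by have := (attack_prob tT).2 E pE; rewrite integral_cst.
Qed.

Lemma mean_attack t Z : (t < T)%N -> (forall o, 0 <= Z o) -> adapted t Z ->
  (\int[P]_(o in attack w t) (Z o)%:E = p%:E * EE Z)%E.
Proof.
move=> tT Z0 mZ; apply: integral_cond_prob (past_sub (ltnW tT)) _ _ _ _ _.
- exact: measurable_attack.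
- exact: ltW.
- by move=> E; exact: past_attackE.
- by move=> o; rewrite lee_fin.
- exact/measurable_EFinP.
Qed.

Lemma mean_calm t Z : (t < T)%N -> (forall o, 0 <= Z o) -> adapted t Z ->
  (\int[P]_(o in ~` attack w t) (Z o)%:E = (1 - p)%:E * EE Z)%E.
Proof.
move=> tT Z0 mZ; apply: integral_cond_prob (past_sub (ltnW tT)) _ _ _ _ _.
- by apply: measurableC; exact: measurable_attack.
- by move: p1; lra.
- by move=> E; exact: past_calmE.
- by move=> o; rewrite lee_fin.
- exact/measurable_EFinP.
Qed.

Lemma mean_split t (f : Omega -> R) : (t < T)%N -> (forall o, 0 <= f o) ->
  measurable_fun setT f ->
  (EE f = \int[P]_(o in ~` attack w t) (f o)%:E +
          \int[P]_(o in attack w t) (f o)%:E)%E.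
Proof.
move=> tT f0 mf; have mA := measurable_attack tT.
rewrite -(setvU (attack w t)) ge0_integral_setU //.
- exact: measurableC.
- by rewrite setvU; exact/measurable_EFinP.
- by move=> o _; rewrite lee_fin.
- exact/disj_setPCr.
Qed.

(** The attack event belongs to the sigma-algebra on which [K t] is conditioned, so its indicator is
    frozen together with [Z] and the bound on [g] is required only at attack outcomes. The factor
    [p] appears afterwards, when [Z], measurable for the past alone, is integrated over that
    event. *)
Lemma mean_attack_kernel t Z c (g : Omega -> borelV R d -> R) : (t < T)%N ->
  (forall o, 0 <= Z o) -> adapted t Z -> 0 <= c ->
  (forall o y, 0 <= g o y) ->
  measurable_fun setT (fun z : g_sigma_algebraType (past_status x0 w t) *
    borelV R d => g z.1 z.2) ->
  {ae P, forall o, attack w t o -> (\int[K t o]_y (g o y)%:E <= c%:E)%E} ->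
  (\int[P]_(o in attack w t) (Z o * g o (w t o))%:E <=
    c%:E * (p%:E * EE Z))%E.
Proof.
move=> tT Z0 mZ c0 g0 mg gc; have mA := measurable_attack tT.
have GM := past_status_sub tT.
pose I o : R := \1_(attack w t) o.
have mZI : measurable_fun setT ((fun o => Z o * I o) :
    g_sigma_algebraType (past_status x0 w t) -> R).
  apply: measurable_funM; first exact: adapted_status.
  apply: measurable_indic; apply: sub_sigma_algebra; by right.
have ZI0 o : 0 <= Z o * I o by rewrite mulr_ge0.
pose h o y := ((Z o * I o) * g o y)%:E.
have h0 o y : (0 <= h o y)%E by rewrite lee_fin mulr_ge0.
have mh : measurable_fun setT (fun z : g_sigma_algebraType (past_status x0 w t) *
    borelV R d => h z.1 z.2).
  apply/measurable_EFinP; apply: measurable_funM => //.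
  exact: (measurableT_comp mZI measurable_fst).
have gE o y : ((Z o * I o)%:E * (g o y)%:E = h o y)%E by [].
have hE o : (\int[K t o]_y h o y = (Z o * I o)%:E * \int[K t o]_y (g o y)%:E)%E.
  rewrite -ge0_integralZl //.
  - apply/measurable_EFinP.
    exact: (measurableT_comp mg (@pair1_measurable _ _
      (g_sigma_algebraType (past_status x0 w t)) (borelV R d) o)).
  - by move=> y _; rewrite lee_fin.
  - by rewrite lee_fin.
apply: (@le_trans _ _ (\int[P]_o h o (w t o))%E).
  rewrite integral_mkcond le_eqVlt; apply/orP; left; apply/eqP.
  apply: eq_integral => o _; rewrite patchE /h /I indicE.
  by case: (o \in _); rewrite ?mulr1 // mulr0 mul0r.
rewrite (cond_law_integral GM (mw tT) (Kw tT) h0 mh).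
apply: (@le_trans _ _ (\int[P]_o (c%:E * (Z o * I o)%:E))%E).
  apply: ae_ge0_le_integral => //.
  - by move=> o _; exact: integral_ge0.
  - apply: measurable_g_sigmaT GM _.
    exact: measurable_cond_mean (Kw tT) h0 mh.
  - by move=> o _; rewrite -EFinM lee_fin mulr_ge0.
  - apply/measurable_EFinP/measurable_funM => //.
    exact: measurable_g_sigmaT GM mZI.
  apply: filterS gc => o go _; rewrite hE [leRHS]muleC.
  rewrite /I indicE; have [oA|oA] := boolP (o \in attack w t).
    by apply: lee_wpmul2l; rewrite ?lee_fin ?mulr1 //; apply: go; rewrite inE in oA.
  by rewrite mulr0 !mul0e.
rewrite ge0_integralZl //; last 2 first.
- apply/measurable_EFinP; exact: measurable_g_sigmaT GM mZI.
- by move=> o _; rewrite lee_fin.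
apply: lee_wpmul2l; first by rewrite lee_fin.
rewrite -(mean_attack tT Z0 mZ) [leRHS]integral_mkcond.
rewrite le_eqVlt; apply/orP; left; apply/eqP.
apply: eq_integral => o _; rewrite patchE /I indicE.
by case: (o \in _); rewrite ?mulr1 // mulr0.
Qed.

(** Used with [c = 2] for the energy and [c = 1 - k] for the excitation. Calm outcomes only need
    [g <= 1] at a zero disturbance, so the factor departs from 1 by an amount proportional to
    [p]. *)
Lemma mean_step t Z c (g : Omega -> borelV R d -> R) : (t < T)%N ->
  (forall o, 0 <= Z o) -> adapted t Z -> 0 <= c ->
  (forall o y, 0 <= g o y) ->
  measurable_fun setT (fun z : g_sigma_algebraType (past_status x0 w t) *
    borelV R d => g z.1 z.2) ->
  (forall o, w t o = 0 -> g o (w t o) <= 1) ->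
  {ae P, forall o, attack w t o -> (\int[K t o]_y (g o y)%:E <= c%:E)%E} ->
  (EE (fun o => (Z o * g o (w t o))%R) <= (1 - p + p * c)%:E * EE Z)%E.
Proof.
move=> tT Z0 mZ c0 g0 mg g1 gc; have mA := measurable_attack tT.
have mZO := adapted_measurable (ltnW tT) mZ.
have mgw : measurable_fun setT (fun o => g o (w t o)).
  have mid := measurable_id_sub (past_status_sub tT).
  exact: (measurableT_comp mg (measurable_fun_pair mid (mw tT))).
have mZg : measurable_fun setT (fun o => Z o * g o (w t o)).
  exact: measurable_funM.
have Zg0 o : 0 <= Z o * g o (w t o) by rewrite mulr_ge0.
rewrite (mean_split tT Zg0 mZg).
have EZ0 : (0 <= EE Z)%E by exact: mean_ge0.
rewrite EFinD ge0_muleDl ?lee_fin ?mulr_ge0 ?(ltW p0) //; last by move: p1; lra.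
apply: leeD.
  rewrite -(mean_calm tT Z0 mZ); apply: ge0_le_integral => //.
  - exact: measurableC.
  - by move=> o _; rewrite lee_fin mulr_ge0.
  - by apply/measurable_funTS/measurable_EFinP; exact: measurable_funM.
  - exact/measurable_funTS/measurable_EFinP.
  - move=> o /= /negP; rewrite negbK => /eqP wo.
    by rewrite lee_fin ler_piMr // g1.
by rewrite mulrC EFinM -muleA; exact: mean_attack_kernel.
Qed.

Definition sign t (o : Omega) : R := calm_sign (w t o).

Lemma adapted_sign t : adapted t.+1 (sign t).
Proof.
have mA : measurable (attack w t : set (g_sigma_algebraType (past x0 w t.+1))).
  by apply: measurable_neq0; exact: past_w.
rewrite /adapted (_ : sign t = (fun o => 1 - 2 * \1_(attack w t) o)).
  apply: measurable_funB => //; apply: measurable_funM => //.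
apply/funext => o; rewrite /sign /calm_sign indicE /attack.
have [wo|wo] := eqVneq (w t o) 0.
  by rewrite memNset ?mulr0 ?subr0 //= wo eqxx.
by rewrite mem_set // -[X in _ * X]/(1 : R); ring.
Qed.

(** Only the conditional probability of an attack enters, not the law of the disturbance. The
    coefficient of [f] is [- 2 p] at calm times and [2 - 2 p] at attack times, the two values in
    [two_point_mgf]; the quadratic compensator allows [f] to be unbounded. *)
Lemma mean_step_sign t Z f : (t < T)%N ->
  (forall o, 0 <= Z o) -> adapted t Z -> adapted t f ->
  (EE (fun o => (Z o * expR (- sign t o * f o + (1 - 2 * p) * f o
     - 8 * f o ^+ 2))%R) <= EE Z)%E.
Proof.
move=> tT Z0 mZ mf; have mA := measurable_attack tT.
have mg a : adapted t (fun o => Z o * expR (a * f o - 8 * f o ^+ 2)).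
  apply: measurable_funM => //; apply: measurableT_comp => //.
  apply: measurable_funB; apply: measurable_funM => //.
  exact: measurable_funX.
have g0 a o : 0 <= Z o * expR (a * f o - 8 * f o ^+ 2).
  by rewrite mulr_ge0 // expR_ge0.
have mgO a := adapted_measurable (ltnW tT) (mg a).
have p' : 0 <= 1 - p by move: p1; lra.
pose F o := Z o * expR (- sign t o * f o + (1 - 2 * p) * f o - 8 * f o ^+ 2).
have F0 o : 0 <= F o by rewrite mulr_ge0 // expR_ge0.
have mF : measurable_fun setT F.
  apply: measurable_funM; first exact: adapted_measurable (ltnW tT) mZ.
  have mfO := adapted_measurable (ltnW tT) mf.
  have msO := adapted_measurable tT (@adapted_sign t).
  apply: measurableT_comp => //; apply: measurable_funB.
    apply: measurable_funD; apply: measurable_funM => //.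
    exact: measurableT_comp.
  apply: measurable_funM => //; exact: measurable_funX.
rewrite (mean_split tT F0 mF) /F.
rewrite (_ : (\int[P]_(o in ~` attack w t) _ = (1 - p)%:E *
    EE (fun o => (Z o * expR (- (2 * p) * f o - 8 * f o ^+ 2))%R))%E); last first.
  rewrite -(mean_calm tT (g0 _) (mg _)); apply: eq_integral => o.
  rewrite inE /= => /negP; rewrite negbK /sign /calm_sign => ->.
  by congr (_ * expR _)%:E; ring.
rewrite (_ : (\int[P]_(o in attack w t) _ = p%:E *
    EE (fun o => (Z o * expR ((2 - 2 * p) * f o - 8 * f o ^+ 2))%R))%E); last first.
  rewrite -(mean_attack tT (g0 _) (mg _)); apply: eq_integral => o.
  rewrite inE /= /sign /calm_sign => /negPf ->.
  by congr (_ * expR _)%:E; ring.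
rewrite -!meanZ //; last exact: ltW.
rewrite -meanD; last 4 first.
- exact: measurable_funM.
- exact: measurable_funM.
- by move=> o; rewrite mulr_ge0.
- by move=> o; rewrite mulr_ge0 // ltW.
apply: le_mean.
- by apply: measurable_funD; exact: measurable_funM.
- exact: adapted_measurable (ltnW tT) mZ.
- by move=> o; rewrite addr_ge0 // mulr_ge0 // ltW.
move=> o; have := two_point_mgf (f o) p0 p1; rewrite !expRB.
have := expR_gt0 (8 * f o ^+ 2); move: (expR (8 * _)) => e e0 H.
rewrite (_ : _ + _ = Z o * (((1 - p) * expR (- (2 * p) * f o)
  + p * expR ((2 - 2 * p) * f o)) / e)); last by ring.
by rewrite ler_piMr // ler_pdivrMr // mul1r.
Qed.

(** Tower property: the product of the earlier factors becomes part of the weight, which is why the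
    one-step bound is required against every adapted [Z']. *)
Lemma mean_prod n c (f : nat -> Omega -> R) Z : (n <= T)%N -> 0 <= c ->
  (forall t o, 0 <= f t o) -> (forall t, (t < n)%N -> adapted t.+1 (f t)) ->
  (forall o, 0 <= Z o) -> adapted 0 Z ->
  (forall t Z', (t < n)%N -> (forall o, 0 <= Z' o) -> adapted t Z' ->
    (EE (fun o => (Z' o * f t o)%R) <= c%:E * EE Z')%E) ->
  (EE (fun o => (Z o * \prod_(t < n) f t o)%R) <= (c ^+ n)%:E * EE Z)%E.
Proof.
move=> nT c0 f0 mf Z0 mZ H.
pose Y m o := Z o * \prod_(t < m) f t o.
have Y0 m o : 0 <= Y m o by rewrite mulr_ge0 // prodr_ge0.
have mY m : (m <= n)%N -> adapted m (Y m).
  elim: m => [_|m IH mn].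
    rewrite (_ : Y 0%N = Z) //; apply/funext => o.
    by rewrite /Y big_ord0 mulr1.
  rewrite (_ : Y m.+1 = (fun o => Y m o * f m o)); last first.
    by apply/funext => o; rewrite /Y big_ord_recr /= mulrA.
  apply: measurable_funM; last exact: mf.
  exact: (adaptedS (leqnSn m)) (IH (ltnW mn)).
suff : forall m, (m <= n)%N -> (EE (Y m) <= (c ^+ m)%:E * EE Z)%E by apply.
elim=> [_|m IH mn].
  rewrite expr0 mul1e le_eqVlt; apply/orP; left; apply/eqP.
  by apply: eq_integral => o _; rewrite /Y big_ord0 mulr1.
have := H m (Y m) mn (Y0 m) (mY m (ltnW mn)).
rewrite (_ : (\int[P]_o (Y m o * f m o)%:E)%E = EE (Y m.+1)); last first.
  by apply: eq_integral => o _; rewrite /Y big_ord_recr /= mulrA.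
move=> /le_trans; apply; rewrite exprS EFinM -muleA.
by apply: lee_wpmul2l; [rewrite lee_fin|exact: IH (ltnW mn)].
Qed.

(** * Exponential moments along the trajectory and the good event *)

Section trajectory.
Variables (A : 'M[R]_d) (x : nat -> Omega -> 'cV[R]_d).
Hypothesis x0E : x 0%N = x0.
Hypothesis dyn : forall t, (t < T)%N ->
  forall o, x t.+1 o = A *m x t o + w t o.

Lemma adapted_x t v : (t <= T)%N -> adapted t (fun o => dotv (x t o) v).
Proof.
elim: t v => [|t IH] v tT.
  by rewrite x0E; apply: measurable_dotv; exact: past_x0.
rewrite (_ : (fun o => _) = (fun o => dotv (x t o) (A^T *m v) + dotv (w t o) v)).
  apply: measurable_funD; last exact: adapted_dotv_w.
  exact: adaptedS (leqnSn t) (IH _ (ltnW tT)).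
by apply/funext => o; rewrite dyn // dotvDl dotv_mulmxl.
Qed.

Lemma adapted_cst t c : adapted t (fun=> c).
Proof. exact: measurable_cst. Qed.

Lemma mean_expR_sign (th : R) v :
  (EE (fun o => expR (\sum_(t < T) (- sign t o * (th * `|dotv (x t o) v|)
      + (1 - 2 * p) * (th * `|dotv (x t o) v|)
      - 8 * (th * `|dotv (x t o) v|) ^+ 2))) <= 1)%E.
Proof.
pose u t o := th * `|dotv (x t o) v|.
have mu_ t : (t <= T)%N -> adapted t (u t).
  move=> tT; apply: measurable_funM => //; apply: measurableT_comp => //.
  exact: adapted_x.
pose f t o := expR (- sign t o * u t o + (1 - 2 * p) * u t o - 8 * u t o ^+ 2).
have := @mean_prod T 1 f (fun=> 1) (leqnn T) ler01 _ _ _ _ _.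
rewrite expr1n mul1e mean_cst.
rewrite (_ : (\int[P]_o (1 * \prod_(t < T) f t o)%:E)%E =
  EE (fun o => expR (\sum_(t < T) (- sign t o * u t o + (1 - 2 * p) * u t o
      - 8 * u t o ^+ 2)))); last first.
  by apply: eq_integral => o _; rewrite mul1r expR_sum.
apply.
- by move=> t o; exact: expR_ge0.
- move=> t tT; apply: measurableT_comp => //; apply: measurable_funB.
    apply: measurable_funD; apply: measurable_funM => //.
    + by apply: measurableT_comp => //; exact: adapted_sign.
    + exact: (adaptedS (leqnSn t)) (mu_ t (ltnW tT)).
    + exact: (adaptedS (leqnSn t)) (mu_ t (ltnW tT)).
  apply: measurable_funM => //; apply: measurable_funX.
  exact: (adaptedS (leqnSn t)) (mu_ t (ltnW tT)).
- by [].
- exact: adapted_cst.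
- move=> t Z' tT Z0 mZ; rewrite mul1e.
  by apply: mean_step_sign => //; exact: mu_ (ltnW tT).
Qed.

Variable s : R.
Hypothesis s0 : 0 < s.
Hypothesis x0_expR : forall v, l2norm v <= 1 ->
  (\int[P]_o (expR (dotv (x0 o) v ^+ 2 / s ^+ 2))%:E <= 2%:E)%E.
Hypothesis K_expR : forall t, (t < T)%N ->
  {ae P, forall o, forall v, l2norm v <= 1 ->
    (\int[K t o]_y (expR (dotv (y : 'cV[R]_d) v ^+ 2 / s ^+ 2))%:E <= 2%:E)%E}.

(** The form vanishes at 0, so a calm step has factor 1, while an attack has factor at most 2. Thus
    [1 - p + 2 p = 1 + p <= expR p], compensated by the subtracted [p * T]; the initial state
    accounts for the remaining 2. *)
Lemma mean_expR_energy (B : 'M[R]_d) (b : R) v :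
  0 < b -> b < 1 -> (forall v, l2norm (B *m v) <= l2norm v) -> l2norm v <= 1 ->
  (EE (fun o => expR ((lyap B b T v (x0 o) +
     \sum_(t < T) lyap B b (T - t.+1) v (w t o)) / s ^+ 2 - p * T%:R)) <=
   2%:E)%E.
Proof.
move=> b0 b1 BC v1.
pose q n (y : 'cV[R]_d) := expR (lyap B b n v y / s ^+ 2).
have mq n (dT : measure_display) (S : measurableType dT) (W : S -> 'cV[R]_d) :
    measurable_fun setT (W : S -> borelV R d) ->
    measurable_fun setT (fun y => q n (W y)).
  move=> mW; apply: measurableT_comp => //; apply: measurable_funM => //.
  exact: measurable_lyap.
have q0 n y : 0 <= q n y by exact: expR_ge0.
have H := @mean_prod T (1 + p) (fun t o => q (T - t.+1)%N (w t o))
  (fun o => q T (x0 o)) (leqnn T) _ _ _ _ _ _.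
have {}H : (EE (fun o => (q T (x0 o) * \prod_(t < T) q (T - t.+1)%N (w t o))%R)
    <= ((1 + p) ^+ T)%:E * 2%:E)%E.
  apply: (le_trans (H _ _ _ _ _ _)).
  - by move: p0; lra.
  - by [].
  - by move=> t tT; apply: mq; exact: past_w.
  - by [].
  - by apply: mq; exact: past_x0.
  - move=> t Z' tT Z0 mZ.
    have -> : 1 + p = 1 - p + p * 2 by ring.
    apply: (@mean_step t Z' 2 (fun _ y => q (T - t.+1)%N y)) => //.
    + have mid : measurable_fun setT (id : borelV R d -> borelV R d) by [].
      exact: (measurableT_comp (mq (T - t.+1)%N _ (borelV R d) id mid)
        measurable_snd).
    + move=> o ->; rewrite /q (_ : lyap _ _ _ _ _ = 0) ?mul0r ?expR0 //.
      elim: (T - t.+1)%N v {q mq q0 H v1} => //= n IH v.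
      by rewrite dotv0l IH expr0n /= !mulr0 addr0.
    + apply: filterS (K_expR tT) => o Ko _.
      exact: (@lyap_expR _ _ _ _ (K t o) id).
  - apply: lee_wpmul2l; first by rewrite lee_fin exprn_ge0 //; move: p0; lra.
    exact: (@lyap_expR _ _ _ _ P x0).
under eq_integral => o _ do rewrite mulrDl mulr_suml expRB expRD expR_sum
  [_ / expR _]mulrC.
have mpr : measurable_fun setT
    (fun o => q T (x0 o) * \prod_(t < T) q (T - t.+1)%N (w t o)).
  apply: measurable_funM; first exact: mq.
  by apply: measurable_prod => t _; apply: mq; exact: mw.
rewrite meanZ //; last by move=> o; rewrite mulr_ge0 // prodr_ge0.
rewrite -[2%:E]mul1e -(_ : (expR (p * T%:R))^-1%:E * (expR (p * T%:R))%:E = 1)%E;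
  last by rewrite -EFinM mulVf // gt_eqF // expR_gt0.
rewrite -muleA; apply: lee_wpmul2l; first by rewrite lee_fin invr_ge0 expR_ge0.
apply: (le_trans H); apply: lee_wpmul2r; rewrite ?lee_fin // mulrC expRM_natl.
by apply: lerXn2r; rewrite ?nnegrE ?expR_ge0 ?expR_ge1Dx //; move: p0; lra.
Qed.

(** The disturbance [w_t] is seen through the next state, with a shift [x_t . A^T v] fixed by the
    past. An attack has factor [1 - k] uniformly in this shift, hence [1 - p + p (1 - k) = 1 - p k
    <= expR (- p k)] whatever the adversary has done. *)
Lemma mean_expR_excite (lam l : R) v n : (n <= T)%N -> 0 < lam ->
  0 < l -> l <= lam * l2norm v -> l2norm v <= 1 -> l <= s ->
  (forall t, (t < T)%N -> {ae P, forall o, attack w t o ->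
    forall z, loewner_le (lam ^+ 2)%:M (shifted_second_moment (K t o) id z)}) ->
  (EE (fun o => expR (p * (l ^+ 4 / (1152 * s ^+ 4)) * n%:R
     - \sum_(t < n) `|dotv (x t.+1 o) v / l|)) <= 1)%E.
Proof.
move=> nT lam0 l0 lv v1 ls ndeg.
set k := l ^+ 4 / (1152 * s ^+ 4).
have l4 : 0 < l ^+ 4 by rewrite exprn_gt0.
have ls4 : l ^+ 4 <= s ^+ 4 by rewrite lerXn2r ?nnegrE // ltW.
have s4 : 0 < 1152 * s ^+ 4 by lra.
have k0 : 0 < k by exact: divr_gt0.
have k1 : k <= 1 by rewrite /k ler_pdivrMr // mul1r; lra.
have pk : 0 <= 1 - p * k by move: p0 p1; nra.
pose g t o (y : borelV R d) :=
  expR (- `|(dotv (x t o) (A^T *m v) + dotv (y : 'cV[R]_d) v) / l|).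
pose f t o := expR (- `|dotv (x t.+1 o) v / l|).
have fE t o : (t < T)%N -> f t o = g t o (w t o).
  by move=> tT; rewrite /f /g dyn // dotvDl dotv_mulmxl.
have H := @mean_prod n (1 - p * k) f (fun=> 1) nT pk _ _ _ _ _.
have {}H : (EE (fun o => (1 * \prod_(t < n) f t o)%R) <=
    ((1 - p * k) ^+ n)%:E)%E.
  rewrite -[leRHS]mule1 -[1%E](mean_cst P 1); apply: H.
  - by move=> t o; exact: expR_ge0.
  - move=> t tn; have tT := leq_trans tn nT.
    apply: measurableT_comp => //; apply: measurableT_comp => //.
    apply: measurableT_comp => //; apply: measurable_funM => //.
    exact: adapted_x.
  - by [].
  - exact: adapted_cst.
  - move=> t Z tn Z0 mZ; have tT := leq_trans tn nT.
    rewrite (_ : (\int[P]_o _)%E = EE (fun o => (Z o * g t o (w t o))%R));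
      last by apply: eq_integral => o _; rewrite fE.
    have -> : 1 - p * k = 1 - p + p * (1 - k) by ring.
    apply: mean_step => //.
    + by rewrite subr_ge0.
    + by move=> o y; exact: expR_ge0.
    + apply: measurableT_comp => //; apply: measurableT_comp => //.
      apply: measurableT_comp => //; apply: measurable_funM => //.
      apply: measurable_funD.
        have := adapted_status (adapted_x (A^T *m v) (ltnW tT)).
        by move=> /measurableT_comp; apply; exact: measurable_fst.
      have mid : measurable_fun setT (id : borelV R d -> borelV R d) by [].
      exact: (measurableT_comp (measurable_dotv v mid) measurable_snd).
    + by move=> o _; rewrite -expR0 ler_expR oppr_le0.
    + have mid : measurable_fun setT (id : borelV R d -> borelV R d) by [].
      apply: filterS2 (K_expR tT) (ndeg t tT) => o Ko No att.
      apply: (@subgaussian_shift_expR _ _ _ (K t o) _ l s) => //.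
      * exact: measurable_dotv v mid.
      * exact: Ko.
      * rewrite -dotv_mulmxl.
        apply: le_trans (loewner_second_moment v s0 Ko (No att (A *m x t o))).
        by rewrite lee_fin lerXn2r ?nnegrE ?(ltW l0) // mulr_ge0 ?l2norm_ge0 // ltW.
under eq_integral => o _ do rewrite -sumrN expRD expR_sum.
have mf t : (t < n)%N -> measurable_fun setT (f t).
  move=> tn; have tT := leq_trans tn nT.
  apply: measurableT_comp => //; apply: measurableT_comp => //.
  apply: measurableT_comp => //; apply: measurable_funM => //.
  exact: adapted_measurable tT (adapted_x v tT).
rewrite (@meanZ _ _ _ P _ (fun o => \prod_(t < n) f t o)) //; last 2 first.
- by apply: measurable_prod => t _; exact: mf.
- by move=> o; apply: prodr_ge0 => t _; exact: expR_ge0.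
rewrite -(_ : (expR (p * k * n%:R))%:E * (expR (p * k * n%:R))^-1%:E = 1)%E;
  last by rewrite -EFinM mulfV // gt_eqF // expR_gt0.
apply: lee_wpmul2l; first by rewrite lee_fin expR_ge0.
under eq_integral => o _ do rewrite -[\prod_(t < n) _]mul1r.
apply: (le_trans H); rewrite lee_fin -expRN.
rewrite (_ : - (p * k * n%:R) = n%:R * - (p * k)); last by ring.
rewrite expRM_natl.
by apply: lerXn2r; rewrite ?nnegrE ?expR_ge0 ?expR_ge1Dx //.
Qed.

(** First moments of coordinates suffice, at the price of the factor [d]. Calm times contribute 0,
    so each time costs [p * s] per coordinate rather than [s]. *)
Lemma mean_total_norm :
  (EE (fun o => (\sum_i `|x0 o i 0| + \sum_(t < T) \sum_i `|w t o i 0|)%R) <=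
    (d%:R * s * (1 + p * T%:R))%:E)%E.
Proof.
have delta1 i : l2norm (delta_mx i 0 : 'cV[R]_d) <= 1.
  rewrite -(@ler_pXn2r _ 2) ?nnegrE ?l2norm_ge0 // l2norm_sqr dotv_delta mxE.
  by rewrite !eqxx expr1n.
have mid : measurable_fun setT (id : borelV R d -> borelV R d) by [].
have mc (dT : measure_display) (S : measurableType dT) (W : S -> 'cV[R]_d) i :
    measurable_fun setT (W : S -> borelV R d) ->
    measurable_fun setT (fun y => `|W y i 0|).
  move=> mW; apply: measurableT_comp => //.
  exact: (measurableT_comp (measurable_coord i) mW).
have Ex i : (EE (fun o => `|x0 o i 0|) <= s%:E)%E.
  under eq_integral do rewrite -(dotv_delta _ i).
  by apply: subgaussian_mean_norm => //; [exact: measurable_dotv|exact: x0_expR].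
have Ew t i : (t < T)%N -> (EE (fun o => `|w t o i 0|) <= (p * s)%:E)%E.
  move=> tT.
  have /= := @mean_attack_kernel t (fun=> 1) s
    (fun _ (y : borelV R d) => `|(y : 'cV[R]_d) i 0|) tT _ _ _ _ _ _.
  rewrite mean_cst mule1 [(p * s)%R]mulrC EFinM => H.
  rewrite (mean_split tT (fun o => normr_ge0 _) (mc _ _ _ i (mw tT))).
  rewrite (_ : (\int[P]_(o in ~` attack w t) _ = 0)%E) ?add0e; last first.
    apply: integral0_eq => o /negP; rewrite negbK => /eqP ->.
    by rewrite mxE normr0.
  under eq_integral do rewrite -[`|_|]mul1r.
  apply: H => //.
  - exact: adapted_cst.
  - exact: ltW.
  - exact: (measurableT_comp (mc _ _ _ i mid) measurable_snd).
  - apply: filterS (K_expR tT) => o Ko _.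
    under eq_integral do rewrite -(dotv_delta _ i).
    apply: subgaussian_mean_norm => //; [exact: measurable_dotv|exact: Ko].
rewrite meanD; last 4 first.
- by apply: measurable_sum => i; exact: mc.
- apply: measurable_sum => t; apply: measurable_sum => i; apply: mc.
  exact: mw.
- by move=> o; exact: sumr_ge0.
- by move=> o; apply: sumr_ge0 => t _; exact: sumr_ge0.
rewrite mulrDr mulr1 EFinD; apply: leeD.
  under eq_integral do rewrite -sumEFin.
  rewrite ge0_integral_sum //; last first.
    by move=> i; apply/measurable_EFinP; exact: mc.
  rewrite -[d in d%:R]card_ord -sumr_const mulr_suml -sumEFin.
  by apply: lee_sum => i _; rewrite mul1r.
under eq_integral do rewrite -sumEFin.
rewrite ge0_integral_sum //; last 2 first.
- move=> t; apply/measurable_EFinP; apply: measurable_sum => i; apply: mc.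
  exact: mw.
- by move=> t o _; rewrite lee_fin sumr_ge0.
rewrite [p * _]mulrC mulrCA -[T in T%:R]card_ord -sumr_const mulr_suml -sumEFin.
apply: lee_sum => t _; rewrite mul1r.
under eq_integral do rewrite -sumEFin.
rewrite ge0_integral_sum //; last first.
  by move=> i; apply/measurable_EFinP; apply: mc; exact: mw.
rewrite -mulrA -[d in d%:R]card_ord -sumr_const mulr_suml -sumEFin.
by apply: lee_sum => i _; rewrite mul1r mulrC; exact: Ew.
Qed.

Definition total_norm o : R :=
  \sum_i `|x0 o i 0| + \sum_(t < T) \sum_i `|w t o i 0|.

Definition recovery_bounds (m : nat) (B : 'M[R]_d) (b th k l e : R) o :=
  forall g : {ffun 'I_d -> 'I_(2 * m).+1}, let v : 'cV[R]_d := grid g in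
    4^-1 <= l2norm v -> l2norm v <= 1 ->
    [/\ \sum_(t < T) (- sign t o * (th * `|dotv (x t o) v|) +
          (1 - 2 * p) * (th * `|dotv (x t o) v|)
          - 8 * (th * `|dotv (x t o) v|) ^+ 2) <= e,
        (lyap B b T v (x0 o) + \sum_(t < T) lyap B b (T - t.+1) v (w t o))
          / s ^+ 2 - p * T%:R <= e &
        p * k * T.-1%:R - \sum_(t < T.-1) `|dotv (x t.+1 o) v / l| <= e].

Lemma recovery_event (m : nat) (B : 'M[R]_d) (b th lam de : R) :
  (0 < d)%N -> 0 < b -> b < 1 -> (forall v, l2norm (B *m v) <= l2norm v) ->
  0 < lam -> lam / 4 <= s ->
  (forall t, (t < T)%N -> {ae P, forall o, attack w t o ->
    forall z, loewner_le (lam ^+ 2)%:M (shifted_second_moment (K t o) id z)}) ->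
  0 < de ->
  exists E : set Omega, [/\ measurable E, ((1 - de)%:E <= P E)%E &
    forall o, E o ->
      total_norm o <= 2 * d%:R * s * (1 + p * T%:R) / de /\
      recovery_bounds m B b th ((lam / 4) ^+ 4 / (1152 * s ^+ 4)) (lam / 4)
        (ln (8 * ((2 * m).+1 ^ d)%:R / de)) o].
Proof.
move=> d0 b0 b1 BC lam0 ls ndeg de0.
(* The retained grid directions have norm at least [4^-1], so [l <= lam * l2norm v]. *)
set l := lam / 4; set k := l ^+ 4 / (1152 * s ^+ 4).
have l0 : 0 < l by rewrite /l; lra.
pose I := {ffun 'I_d -> 'I_(2 * m).+1}.
pose good (g : I) := (4^-1 <= l2norm (grid g : 'cV[R]_d)) &&
  (l2norm (grid g : 'cV[R]_d) <= 1).
pose X1 (v : 'cV[R]_d) o := \sum_(t < T) (- sign t o * (th * `|dotv (x t o) v|)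
  + (1 - 2 * p) * (th * `|dotv (x t o) v|)
  - 8 * (th * `|dotv (x t o) v|) ^+ 2).
pose X2 (v : 'cV[R]_d) o := (lyap B b T v (x0 o) +
  \sum_(t < T) lyap B b (T - t.+1) v (w t o)) / s ^+ 2 - p * T%:R.
pose X3 (v : 'cV[R]_d) o :=
  p * k * T.-1%:R - \sum_(t < T.-1) `|dotv (x t.+1 o) v / l|.
have mx t v : (t <= T)%N -> measurable_fun setT (fun o => dotv (x t o) v).
  by move=> tT; exact: adapted_measurable tT (adapted_x v tT).
have mX1 v : measurable_fun setT (X1 v).
  have ma (t : 'I_T) : measurable_fun setT (fun o => th * `|dotv (x t o) v|).
    apply: measurable_funM => //; apply: measurableT_comp => //.
    exact: mx (ltnW (ltn_ord t)).
  apply: measurable_sum => t; apply: measurable_funB.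
    apply: measurable_funD; apply: measurable_funM => //.
    apply: measurableT_comp => //.
    exact: adapted_measurable (ltn_ord t) (@adapted_sign t).
  apply: measurable_funM => //; exact: measurable_funX.
have mX2 v : measurable_fun setT (X2 v).
  apply: measurable_funB => //; apply: measurable_funM => //.
  apply: measurable_funD; first exact: measurable_lyap.
  by apply: measurable_sum => t; apply: measurable_lyap; exact: mw.
have mX3 v : measurable_fun setT (X3 v).
  apply: measurable_funB => //; apply: measurable_sum => t.
  apply: measurableT_comp => //; apply: measurable_funM => //.
  exact: mx (leq_trans (ltn_ord t) (leq_pred T)).
have me (X : 'cV[R]_d -> Omega -> R) v : measurable_fun setT (X v) ->
    measurable_fun setT (fun o => expR (X v o)).
  by move=> mX; exact: measurableT_comp.
(* The moment bounds hold for directions in the shell only; the other grid points get weight 0. In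
   the shell the three means are at most 1, 2 and 1, whence the bound 4 below. *)
pose F (g : I) o : R := if good g then
  expR (X1 (grid g) o) + (expR (X2 (grid g) o) + expR (X3 (grid g) o)) else 0.
have F0 g o : 0 <= F g o.
  by rewrite /F; case: ifP => // _; rewrite !addr_ge0 ?expR_ge0.
have mF g : measurable_fun setT (F g).
  rewrite /F; case: (good g) => //.
  by apply: measurable_funD; [|apply: measurable_funD]; exact: me.
have EF g : (EE (F g) <= 4%:E)%E.
  rewrite /F; have [/andP[g1 g2]|_] := boolP (good g); last first.
    by rewrite mean_cst lee_fin.
  rewrite meanD; last 4 first.
  - exact: me.
  - by apply: measurable_funD; exact: me.
  - by move=> o; exact: expR_ge0.
  - by move=> o; rewrite addr_ge0 ?expR_ge0.
  rewrite meanD; last 4 first.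
  - exact: me.
  - exact: me.
  - by move=> o; exact: expR_ge0.
  - by move=> o; exact: expR_ge0.
  rewrite (_ : 4%:E = 1 + (2%:E + 1))%E; last first.
    by rewrite -!EFinD; congr _%:E; ring.
  apply: leeD; first exact: mean_expR_sign.
  apply: leeD; first exact: mean_expR_energy.
  rewrite /X3 (_ : p * k * _ = p * (l ^+ 4 / (1152 * s ^+ 4)) * T.-1%:R) //.
  apply: (@mean_expR_excite lam) => //; first exact: leq_pred.
  by rewrite /l ler_pM2l.
pose n : R := ((2 * m).+1 ^ d)%:R.
have n0 : 0 < n by rewrite ltr0n expn_gt0.
have p0' := ltW p0.
have pT : 0 <= p * T%:R by rewrite mulr_ge0 ?ler0n.
have dp : 0 < d%:R :> R by rewrite ltr0n.
pose u : R := d%:R * s * (1 + p * T%:R).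
have u0 : 0 < u by rewrite /u !mulr_gt0 // ltr_wpDr.
have mtot : measurable_fun setT total_norm.
  have mc (W : Omega -> 'cV[R]_d) i :
      measurable_fun setT (W : Omega -> borelV R d) ->
      measurable_fun setT (fun y => `|W y i 0|).
    move=> mW; apply: measurableT_comp => //.
    exact: (measurableT_comp (measurable_coord i) mW).
  apply: measurable_funD; first by apply: measurable_sum => i; exact: mc.
  apply: measurable_sum => t; apply: measurable_sum => i; apply: mc; exact: mw.
have tot0 o : 0 <= total_norm o.
  by rewrite addr_ge0 ?sumr_ge0 // => t _; exact: sumr_ge0.
have Fs0 o : 0 <= \sum_g F g o by exact: sumr_ge0.
have c1 : 0 <= de / (8 * n) by rewrite divr_ge0 ?mulr_ge0 // ltW.
have u2 : 0 < 2 * u by exact: mulr_gt0.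
have c2 : 0 <= de / (2 * u) by apply: divr_ge0; exact: ltW.
(* A single Markov inequality covers everything: half of [de] goes to the [n] grid points, of mean
   at most 4 each, and half to the total norm, of mean at most [u]. Where [H o < 1], each
   exponential is at most [8 n / de], whose logarithm is the bound claimed. *)
pose H o := de / (8 * n) * (\sum_g F g o) + de / (2 * u) * total_norm o.
have mFs : measurable_fun setT (fun o => \sum_g F g o).
  by apply: measurable_sum => g.
have EH : (EE H <= de%:E)%E.
  rewrite meanD; last 4 first.
  - exact: measurable_funM.
  - exact: measurable_funM.
  - by move=> o; exact: mulr_ge0.
  - by move=> o; exact: mulr_ge0.
  rewrite (meanZ mFs Fs0 c1) (meanZ mtot tot0 c2).
  rewrite (_ : de%:E = (de / (8 * n))%:E * (4 * n)%:E + (de / (2 * u))%:E * u%:E)%E;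
    last first.
    by rewrite -!EFinM -EFinD; congr _%:E; field; rewrite !gt_eqF.
  apply: leeD; apply: lee_wpmul2l; rewrite ?lee_fin //; last exact: mean_total_norm.
  under eq_integral do rewrite -sumEFin.
  rewrite ge0_integral_sum //; last 2 first.
  - by move=> g; exact/measurable_EFinP.
  - by move=> g o _; rewrite lee_fin.
  apply: (@le_trans _ _ (\sum_(g : I) 4%:E)%E).
    by apply: lee_sum => g _; exact: EF.
  rewrite sumEFin sumr_const card_ffun !card_ord lee_fin.
  by rewrite /n [leRHS]mulr_natr.
have H0 o : 0 <= H o by apply: addr_ge0; exact: mulr_ge0.
have mH : measurable_fun setT H.
  by apply: measurable_funD; exact: measurable_funM.
have [mE PE] := markov_lt1 mH H0 EH.
exists [set o | H o < 1]; split=> // o /= Ho.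
have tot : de / (2 * u) * total_norm o <= 1.
  apply: le_trans (ltW Ho); rewrite lerDr; exact: mulr_ge0.
split.
  rewrite (_ : 2 * d%:R * s * _ / de = 2 * u / de); last by rewrite /u; ring.
  rewrite ler_pdivlMr //; move: tot.
  by rewrite mulrAC (ler_pdivrMr _ _ u2) mul1r mulrC.
move=> g v v1 v2.
have Fle : F g o <= 8 * n / de.
  have : de / (8 * n) * F g o <= 1.
    apply: le_trans (ltW Ho); rewrite -[leLHS]addr0; apply: lerD.
      rewrite ler_wpM2l // (bigD1 g) //= lerDl.
      by apply: sumr_ge0 => j _; exact: F0.
    exact: mulr_ge0.
  have n8 : 0 < 8 * n by rewrite mulr_gt0.
  by rewrite ler_pdivlMr // mulrAC ler_pdivrMr // mul1r mulrC.
have e1 y : expR y <= F g o -> y <= ln (8 * n / de).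
  move=> yF; rewrite -[y]expRK ler_ln ?posrE ?expR_gt0 //; first exact: le_trans yF Fle.
  by rewrite divr_gt0 // mulr_gt0.
have FE : F g o = expR (X1 v o) + (expR (X2 v o) + expR (X3 v o)).
  by rewrite /F /good v1 v2.
have E1 := expR_ge0 (X1 v o); have E2 := expR_ge0 (X2 v o).
have E3 := expR_ge0 (X3 v o).
split; apply: e1; rewrite FE.
- by rewrite lerDl addr_ge0.
- by rewrite addrCA lerDl addr_ge0.
- by rewrite addrA lerDr addr_ge0.
Qed.

End trajectory.

End system.

Theorem theorem3 (R : realType) :
  exists C : R, 0 < C /\
  forall (dO : measure_display) (Omega : measurableType dO)
    (P : probability Omega R) (d T : nat) (Astar : 'M[R]_d)
    (x w : nat -> Omega -> 'cV[R]_d)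
    (K : nat -> Omega -> probability (borelV R d) R)
    (sigma_w lambda p delta : R),
    (0 < d)%N ->
    measurable_fun setT (x 0%N : Omega -> borelV R d) ->
    (forall t, (t < T)%N -> measurable_fun setT (w t : Omega -> borelV R d)) ->
    (forall t, (t < T)%N ->
      forall omega, x t.+1 omega = Astar *m x t omega + w t omega) ->
    (forall t, (t < T)%N -> is_cond_law P (past_status (x 0%N) w t) (w t) (K t)) ->
    (* operator norm *)
    opnorm Astar < 1 ->
    (* maximum sub-Gaussian norm, at attack and at non-attack times *)
    0 < sigma_w ->
    (psi2_vnorm P (x 0%N) <= sigma_w%:E)%E ->
    (forall t, (t < T)%N ->
      {ae P, forall omega, (psi2_vnorm (K t omega) id <= sigma_w%:E)%E}) ->
    (* probabilistic attack *)
    0 < p -> p < 2^-1 ->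
    (forall t, (t < T)%N ->
      is_cond_prob P (past (x 0%N) w t) (~` attack w t) (cst (1 - p)%:E)) ->
    (* non-degeneracy at attack times *)
    0 < lambda ->
    (forall t, (t < T)%N ->
      {ae P, forall omega, attack w t omega -> forall z : 'cV[R]_d,
        loewner_le (lambda ^+ 2)%:M
          (shifted_second_moment (K t omega) id z)}) ->
    0 < delta -> delta <= 1 ->
    let tau := sigma_w / lambda in
    C * (d%:R * Num.max 1 (tau ^+ 10)
         / (p * (1 - 2 * p) ^+ 2 * (1 - opnorm Astar) ^+ 2))
      * Num.max 1 (ln (d%:R * tau
                       / (delta * (1 - 2 * p) * (1 - opnorm Astar))))
      <= T%:R ->
    exists E : set Omega,
      [/\ measurable E,
          ((1 - delta)%:E <= P E)%E &
          forall omega, E omega ->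
            unique_minimizer (l1_objective T (fun t => x t omega)) Astar].
Proof.
have one_le (n : nat) : 1 <= n.+1%:R :> R by rewrite ler1n.
(* Successor forms of 1152, from the excitation bound, and of 4096, from [signed_sum_lower]. *)
have [C [C0 HC]] := sample_size (one_le 1151%N) (one_le 4095%N).
exists C; split=> // dO Omega P d T A x w K sg lam p de d0 mx0 mw dyn Kw A1.
move=> sg0 x0s Ks p0 p1 att lam0 ndeg de0 de1 tau hT.
pose s := 2 * sg; have s0 : 0 < s by rewrite /s; lra.
have sgs : sg < s by rewrite /s; lra.
have A0 := opnorm_ge0 A.
have mid : measurable_fun setT (id : borelV R d -> borelV R d) by [].
have x0e v : l2norm v <= 1 ->
    (\int[P]_o (expR (dotv (x 0%N o) v ^+ 2 / s ^+ 2))%:E <= 2%:E)%E.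
  exact: psi2_vnorm_expR mx0 sgs x0s.
have Ke t : (t < T)%N -> {ae P, forall o, forall v, l2norm v <= 1 ->
    (\int[K t o]_y (expR (dotv (y : 'cV[R]_d) v ^+ 2 / s ^+ 2))%:E <= 2%:E)%E}.
  move=> tT; apply: filterS (Ks t tT) => o Ko v.
  exact: (@psi2_vnorm_expR _ _ _ _ (K t o) id _ _ v mid sgs Ko).
have T0 : (0 < T)%N.
  rewrite -(ltr0n R); apply: lt_le_trans hT; apply: mulr_gt0; last first.
    by rewrite lt_max ltr01.
  apply: mulr_gt0 => //; apply: divr_gt0.
    by rewrite mulr_gt0 ?ltr0n // lt_max ltr01.
  apply: mulr_gt0; last by rewrite exprn_gt0 // subr_gt0.
  by apply: mulr_gt0 => //; rewrite exprn_gt0 //; lra.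
(* An attack at time 0 has probability [p > 0], so some attack outcome satisfies both almost sure
   conditions on [K 0]. For a unit vector [v], the second moment of [y . v] there is at least
   [lam^2] and at most [2 s^2]. *)
have lams : lam / 4 <= s.
  have [om [oA [Ko No]]] : exists o, attack w 0%N o /\
      ((forall v : 'cV[R]_d, l2norm v <= 1 ->
        (\int[K 0%N o]_y (expR (dotv (y : 'cV[R]_d) v ^+ 2 / s ^+ 2))%:E <=
          2%:E)%E) /\
       forall z : 'cV[R]_d,
         loewner_le (lam ^+ 2)%:M (shifted_second_moment (K 0%N o) id z)).
    apply: contrapT => noo.
    have aeN : {ae P, forall o, ~ attack w 0%N o}.
      apply: filterS2 (Ke 0%N T0) (ndeg 0%N T0) => o Ko No oA.
      by apply: noo; exists o; split=> //; split=> //; exact: No.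
    have [N [mN PN0 AN]] := aeN.
    have : (P (attack w 0%N) <= P N)%E.
      apply: le_measure; rewrite ?inE //; first by have := measurable_attack mw T0.
      by move=> o oA; apply: AN => /(_ oA).
    rewrite PN0 -(setTI (attack w 0%N)).
    have pT : <<s past (x 0%N) w 0%N >> setT.
      exact: (@measurableT _ (g_sigma_algebraType (past (x 0%N) w 0%N))).
    by rewrite (past_attackE mx0 mw att T0 pT) probability_setT mule1 lee_fin leNgt p0.
  pose v := delta_mx (Ordinal d0) 0 : 'cV[R]_d.
  have v1 : l2norm v = 1.
    apply/eqP; rewrite -(@eqrXn2 _ 2) ?l2norm_ge0 // l2norm_sqr dotv_delta mxE.
    by rewrite !eqxx expr1n.
  have := loewner_second_moment v s0 Ko (No 0).
  rewrite v1 mulr1; under eq_integral do rewrite dotv0l add0r.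
  have v1' : l2norm v <= 1 by rewrite v1.
  move=> /le_trans /(_ (subgaussian_mean_sqr s0 (measurable_dotv v mid) (Ko v v1'))).
  rewrite lee_fin => H; clear -H s0 lam0; nra.
have [m [m0 [N2 e0 eN dm dS]]] := HC d T sg lam p de (opnorm A) d0 sg0 lam0 lams
  p0 p1 de0 de1 A0 A1 hT.
move: N2 e0 eN dm dS; rewrite -/s.
set l := lam / 4; set k := l ^+ 4 / _; set N := p * T%:R; set q := 1 - 2 * p.
set e := ln _ => N2 e0 eN dm dS.
(* The midpoint between [opnorm A] and 1 is positive even for [A = 0], so [B] is defined and is a
   contraction, while [1 - b] is only half of [1 - opnorm A]. *)
pose b := (1 + opnorm A) / 2.
have b0 : 0 < b by rewrite /b; clear -A0; lra.
have b1 : b < 1 by rewrite /b; clear -A1; lra.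
have rE : (1 - opnorm A) / 2 = 1 - b by rewrite /b; field.
rewrite rE in eN.
pose B := b^-1 *: A^T.
have AB : A^T = b *: B by rewrite /B scalerA mulfV ?scale1r // gt_eqF.
have BC v : l2norm (B *m v) <= l2norm v.
  rewrite /B -scalemxAl l2normZ gtr0_norm ?invr_gt0 // ler_pdivrMl //.
  apply: le_trans (l2norm_trmx A v) _; rewrite ler_wpM2r ?l2norm_ge0 //.
  by rewrite /b; clear -A1; lra.
pose th := q * l * k * (1 - b) ^+ 2 / (256 * s ^+ 2).
have [E [mE PE HE]] := recovery_event mx0 mw Kw p0 p1 att (erefl (x 0%N)) dyn
  s0 x0e Ke m th d0 b0 b1 BC lam0 lams ndeg de0.
exists E; split=> // o /HE[tot good].
have l0 : 0 < l by rewrite /l; clear -lam0; lra.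
have l4 : 0 < l ^+ 4 by rewrite exprn_gt0.
have ls4 : l ^+ 4 <= s ^+ 4 by rewrite lerXn2r ?nnegrE // ltW.
have s4 : 0 < 1152 * s ^+ 4 by clear -l4 ls4; lra.
have k0 : 0 < k by exact: divr_gt0.
have k1 : k <= 1.
  rewrite /k ler_pdivrMr // mul1r; clear -l4 ls4; lra.
have T1 : (1 < T)%N.
  rewrite -(ltr_nat R); have : N <= T%:R / 2.
    by rewrite /N mulrC ler_wpM2l ?ler0n // ltW.
  clear -N2; lra.
apply: (@recovery_path R d T m A B (fun t => x t o) (fun t => w t o)
  p N q l s k b de e th) => //.
- by move=> t tT; exact: dyn.
- by rewrite /q; clear -p1; lra.
- by rewrite /q; clear -p0; lra.
- apply: le_trans tot; apply: lerD; first exact: l2norm_le_sum.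
  by apply: ler_sum => t _; exact: l2norm_le_sum.
Qed.
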